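(* Let $n\ge 4$. The integral kinematic space $K_n(\mathbb{Z})$ is naturally isomorphic to the character lattice $\Lambda(\mathcal{M}_{0,n})=\mathbb{C}[\mathcal{M}_{0,n}]^\times/\mathbb{C}^\times$, the isomorphism sending an integral point $(s_{ij})$ to the class of the regular function $\prod_{i<j}(\sigma_i-\sigma_j)^{s_{ij}}$ on $\mathcal{M}_{0,n}$. The integral dual kinematic space $K_n^*(\mathbb{Z})$ is naturally isomorphic to the cocharacter lattice $\Lambda^\vee(\mathcal{M}_{0,n})=\operatorname{Hom}(\Lambda(\mathcal{M}_{0,n}),\mathbb{Z})$.
   Context: $\mathcal{M}_{0,n}$ is the moduli space (over $\mathbb{C}$) of $n$ distinct points $\sigma_1,\dots,\sigma_n$ on $\mathbb{P}^1$ modulo the simultaneous action of $\mathrm{PGL}(2)$. The group $\Lambda(\mathcal{M}_{0,n})=\mathbb{C}[\mathcal{M}_{0,n}]^\times/\mathbb{C}^\times$ of units of the coordinate ring modulo scalars is free abelian of finite rank. Kinematic space $K_n$ is the $(\binom n2-n)$-dimensional complex vector space of symmetric $n\times n$ matrices $(s_{ij})$ with $s_{ii}=0$ and all row sums zero: $\sum_{j\ne i}s_{ij}=0$ for every $i$. The entries $s_{ij}$ are viewed as linear functionals in $K_n^*$. Set $K_n^*(\mathbb{Z}):=\operatorname{span}_{\mathbb{Z}}\{s_{ij}\}\subset K_n^*$ and $K_n(\mathbb{Z}):=\{\underline{s}\in K_n\mid f(\underline s)\in\mathbb{Z}\text{ for all }f\in K_n^*(\mathbb{Z})\}=\{\underline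 s\in K_n\mid s_{ij}\in\mathbb{Z}\}$. For $\underline s\in K_n(\mathbb{Z})$, the product $\prod_{i<j}(\sigma_i-\sigma_j)^{s_{ij}}$ is invariant under $\mathrm{PGL}(2)$ up to sign/scalar and defines a class of units on $\mathcal{M}_{0,n}$. *)

(* Defs.v *)
From HB Require Import structures.
From mathcomp Require Import all_boot all_order all_algebra.
From mathcomp Require Import complex.
From mathcomp Require Import boolp functions reals.
From mathcomp Require Import mpoly.

Set Implicit Arguments.
Unset Strict Implicit.
Unset Printing Implicit Defensive.

Import GRing.Theory Num.Theory.
Local Open Scope ring_scope.
Local Open Scope quotient_scope.

(* [units A] is A^x.  It carries a zmodType structure, so its group law, the
   multiplication of A, is written additively: val (u + v) = val u * val v,
   val 0 = 1. *)
Record units (A : comPzRingType) := Units {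
  units_val : A;
  _ : `[< exists b, units_val * b = 1 >] }.

Section Units.
Variable A : comPzRingType.
Implicit Types u v w : units A.

HB.instance Definition _ := [isSub for @units_val A].
HB.instance Definition _ := [Choice of units A by <:].

Lemma units_inv_proof u : exists b, val u * b = 1.
Proof. by case: u => a /= /asboolP. Qed.

Definition units_inv u : A := sval (cid (units_inv_proof u)).

Lemma units_invP u : val u * units_inv u = 1.
Proof. by rewrite /units_inv; case: cid. Qed.

Lemma units_one_subproof : `[< exists b, (1 : A) * b = 1 >].
Proof. by apply/asboolP; exists 1; rewrite mulr1. Qed.

Lemma units_mul_subproof u v : `[< exists b, (val u * val v) * b = 1 >].
Proof.
apply/asboolP; exists (units_inv u * units_inv v).
by rewrite mulrACA !units_invP mulr1.
Qed.

Lemma units_inv_subproof u : `[< exists b, units_inv u * b = 1 >].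
Proof. by apply/asboolP; exists (val u); rewrite mulrC units_invP. Qed.

Definition units_zero := Units units_one_subproof.
Definition units_add u v := Units (units_mul_subproof u v).
Definition units_opp u := Units (units_inv_subproof u).

Lemma units_addA : associative units_add.
Proof. by move=> u v w; apply: val_inj; rewrite /= mulrA. Qed.
Lemma units_addC : commutative units_add.
Proof. by move=> u v; apply: val_inj; rewrite /= mulrC. Qed.
Lemma units_add0 : left_id units_zero units_add.
Proof. by move=> u; apply: val_inj; rewrite /= mul1r. Qed.
Lemma units_addN : left_inverse units_zero units_opp units_add.
Proof. by move=> u; apply: val_inj; rewrite /= mulrC units_invP. Qed.

HB.instance Definition _ :=
  GRing.isZmodule.Build (units A) units_addA units_addC units_add0 units_addN.

Lemma units_valD u v : val (u + v) = val u * val v.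
Proof. by []. Qed.
Lemma units_val0 : val (0 : units A) = 1.
Proof. by []. Qed.
Lemma units_valN u : val u * val (- u) = 1.
Proof. exact: units_invP. Qed.

End Units.

Definition int_dual_pred (L : zmodType) : {pred L -> int} :=
  fun f => `[< forall x y, f (x - y) = f x - f y >].

Lemma int_dual_zmod_closed (L : zmodType) : zmod_closed (@int_dual_pred L).
Proof.
split=> [|f g /asboolP hf /asboolP hg]; apply/asboolP=> x y.
  by rewrite subr0.
have E h z : (f - h) z = f z - h z by [].
by rewrite !E hf hg !opprD !opprK addrACA.
Qed.

HB.instance Definition _ (L : zmodType) :=
  GRing.isZmodClosed.Build (L -> int) (@int_dual_pred L)
    (@int_dual_zmod_closed L).

Record int_dual (L : zmodType) := IntDual {
  int_dual_fun :> L -> int;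
  _ : int_dual_fun \in @int_dual_pred L }.

HB.instance Definition _ (L : zmodType) := [isSub for @int_dual_fun L].
HB.instance Definition _ (L : zmodType) := [Choice of int_dual L by <:].
HB.instance Definition _ (L : zmodType) :=
  [SubChoice_isSubZmodule of int_dual L by <:].

Section Moduli.
Variables (R : realType) (n : nat).
Local Notation C := R[i].

(* A point of (P^1)^n in homogeneous coordinates is an n x 2 matrix with
   nonzero rows, the point sigma_i being [A i 0 : A i 1]; two points are
   distinct iff the corresponding 2 x 2 minor does not vanish. *)
Definition is_conf (A : 'M[C]_(n, 2)) : bool :=
  [forall i, row i A != 0] &&
  [forall i, forall j, (i != j) ==> (A i 0 * A j 1 - A i 1 * A j 0 != 0)].

Record conf := Conf { conf_mx :> 'M[C]_(n, 2); _ : is_conf conf_mx }.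

HB.instance Definition _ := [isSub for conf_mx].
HB.instance Definition _ := [Choice of conf by <:].

(* A and B define the same point of (P^1)^n / PGL(2): the row rescalings t
   change the homogeneous coordinates, and g acts simultaneously on the rows. *)
Definition pgl_equiv (A B : conf) : bool :=
  `[< exists (t : 'rV[C]_n) (g : 'M[C]_2),
        [/\ forall i, t 0 i != 0, g \in unitmx
          & conf_mx B = diag_mx t *m A *m g] >].

Lemma pgl_equiv_refl : reflexive pgl_equiv.
Proof.
move=> A; apply/asboolP; exists (const_mx 1), 1%:M; split.
- by move=> i; rewrite mxE oner_neq0.
- exact: unitmx1.
- by rewrite diag_const_mx mul1mx mulmx1.
Qed.

Lemma pgl_equiv_sym : ssrbool.symmetric pgl_equiv.
Proof.
suff H A B : pgl_equiv A B -> pgl_equiv B A by move=> A B; apply/idP/idP=> /H.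
case/asboolP=> t [g [t0 gU EB]]; apply/asboolP.
exists (\row_i (t 0 i)^-1), (invmx g); split.
- by move=> i; rewrite mxE invr_eq0.
- by rewrite unitmx_inv.
- rewrite EB -!mulmxA mulmxV // mulmx1 mulmxA mulmx_diag.
  rewrite (_ : \row__ _ = const_mx 1) ?diag_const_mx ?mul1mx //.
  by apply/rowP=> i; rewrite !mxE mulVf.
Qed.

Lemma pgl_equiv_trans : transitive pgl_equiv.
Proof.
move=> B A D /asboolP [t [g [t0 gU EB]]] /asboolP [t' [g' [t0' gU' ED]]].
apply/asboolP; exists (\row_i (t' 0 i * t 0 i)), (g *m g'); split.
- by move=> i; rewrite mxE mulf_neq0.
- by rewrite unitmx_mul gU.
- by rewrite ED EB !mulmxA mulmx_diag.
Qed.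

Canonical pgl_equiv_equivRel :=
  EquivRel pgl_equiv pgl_equiv_refl pgl_equiv_sym pgl_equiv_trans.

Definition M0n := {eq_quot pgl_equiv}.
HB.instance Definition _ := Choice.on M0n.

Definition M0n_class (A : conf) : M0n := \pi_M0n A.

(* The affine coordinate of sigma_i, meaningful when sigma_i <> oo, i.e. when
   A i 1 != 0.  Every class in M_{0,n} is represented by a configuration of
   points distinct from oo. *)
Definition sigma (A : conf) (i : 'I_n) : C := A i 0 / A i 1.

(* P is multihomogeneous of multidegree d, as a polynomial in the n pairs of
   homogeneous coordinates of (P^1)^n; the variable of index mxvec_index i k
   stands for the entry (i, k). *)
Definition multihomog (d : 'I_n -> nat) (P : {mpoly C[n * 2]}) : Prop :=
  forall m, m \in msupp P ->
  forall i : 'I_n,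
    (m (mxvec_index i (0%R : 'I_2)) + m (mxvec_index i (1%R : 'I_2)))%N = d i.

Definition conf_eval (P : {mpoly C[n * 2]}) (A : conf) : C :=
  P.@[mxvec (conf_mx A) 0].

(* A function on M_{0,n} is regular iff its pullback to the open subset of
   (P^1)^n formed by the configurations of distinct points is regular, i.e.
   locally a quotient of two multihomogeneous polynomials of the same
   multidegree.  (The quotient by the free action of PGL(2) is geometric, so
   that regular functions on it are the invariant regular functions.) *)
Definition regular (f : M0n -> C) : Prop :=
  forall A : conf, exists (d : 'I_n -> nat) (P Q : {mpoly C[n * 2]}),
    [/\ multihomog d P, multihomog d Q, conf_eval Q A != 0
      & forall B : conf, conf_eval Q B != 0 ->
          f (M0n_class B) = conf_eval P B / conf_eval Q B].

Definition regular_pred : {pred M0n -> C} := fun f => `[< regular f >].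

Lemma multihomogM d e P Q : multihomog d P -> multihomog e Q ->
  multihomog (fun i => d i + e i)%N (P * Q).
Proof.
move=> hP hQ m /msuppM_le/allpairsP[[m1 m2] /= [/hP h1 /hQ h2 ->]] i.
by rewrite !mnmDE addnACA h1 h2.
Qed.

Lemma multihomogB d P Q : multihomog d P -> multihomog d Q ->
  multihomog d (P - Q).
Proof.
by move=> hP hQ m /msuppB_le; rewrite mem_cat => /orP[/hP|/hQ].
Qed.

Lemma regular_subring_closed : subring_closed regular_pred.
Proof.
split=> [|f g /asboolP hf /asboolP hg|f g /asboolP hf /asboolP hg];
  apply/asboolP=> A.
- exists (fun=> 0%N), 1, 1.
  have h1 : multihomog (fun=> 0%N) 1.
    by move=> m; rewrite msupp1 inE => /eqP-> i; rewrite !mnmE.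
  have e1 B : conf_eval 1 B = 1 by rewrite /conf_eval meval1.
  by split=> // [|B _]; rewrite !e1 ?oner_neq0 ?divr1.
- have [d [P [Q [hP hQ QA E]]]] := hf A; have [e [S [T [hS hT TA F]]]] := hg A.
  exists (fun i => d i + e i)%N, (P * T - S * Q), (Q * T); split.
  + apply: multihomogB; first exact: multihomogM.
    by rewrite mulrC; apply: multihomogM.
  + exact: multihomogM.
  + by rewrite /conf_eval mevalM mulf_neq0.
  + move=> B; rewrite /conf_eval mevalB !mevalM mulf_eq0 negb_or => /andP[QB TB].
    have -> : (f - g) (M0n_class B) = f (M0n_class B) - g (M0n_class B) by [].
    by rewrite (E B QB) (F B TB) -mulNr addf_div // mulNr.
- have [d [P [Q [hP hQ QA E]]]] := hf A; have [e [S [T [hS hT TA F]]]] := hg A.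
  exists (fun i => d i + e i)%N, (P * S), (Q * T); split.
  + exact: multihomogM.
  + exact: multihomogM.
  + by rewrite /conf_eval mevalM mulf_neq0.
  + move=> B; rewrite /conf_eval !mevalM mulf_eq0 negb_or => /andP[QB TB].
    have -> : (f * g) (M0n_class B) = f (M0n_class B) * g (M0n_class B) by [].
    by rewrite (E B QB) (F B TB) mulf_div.
Qed.

HB.instance Definition _ :=
  GRing.isSubringClosed.Build (M0n -> C) regular_pred regular_subring_closed.

Record coord_ring := CoordRing {
  coord_fun :> M0n -> C;
  _ : coord_fun \in regular_pred }.

HB.instance Definition _ := [isSub for coord_fun].
HB.instance Definition _ := [Choice of coord_ring by <:].
HB.instance Definition _ :=
  GRing.SubChoice_isSubComPzRing.Build _ _ coord_ring
    (subringClosedP regular_pred).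

(* The subgroup C^x of nonzero constants. *)
Definition scalar_units : {pred units coord_ring} :=
  fun u => `[< exists2 c : C, c != 0 & forall x, coord_fun (units_val u) x = c >].

Lemma scalar_units_zmod_closed : zmod_closed scalar_units.
Proof.
split=> [|u v /asboolP[c c0 uE] /asboolP[d d0 vE]]; apply/asboolP.
  by exists 1; rewrite ?oner_neq0.
exists (c / d); first by rewrite mulf_neq0 ?invr_eq0.
move=> x.
have vN : coord_fun (units_val v) x * coord_fun (units_val (- v)) x = 1.
  by have /(congr1 coord_fun)/(congr1 (fun f : M0n -> C => f x)) := units_valN v.
have -> : coord_fun (units_val (u - v)) x =
          coord_fun (units_val u) x * coord_fun (units_val (- v)) x by [].
by rewrite uE; congr (_ * _); apply: (mulfI d0); rewrite mulfV // -(vE x).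
Qed.

HB.instance Definition _ :=
  GRing.isZmodClosed.Build (units coord_ring) scalar_units
    scalar_units_zmod_closed.

Definition char_lattice : Type := Quotient.quot scalar_units.
HB.instance Definition _ := GRing.Zmodule.on char_lattice.

Definition unit_class (u : units coord_ring) : char_lattice :=
  \pi_(Quotient.quot scalar_units) u.

Definition cochar_lattice : Type := int_dual char_lattice.
HB.instance Definition _ := GRing.Zmodule.on cochar_lattice.

Definition kin_asym (S : 'M[C]_n) : 'M[C]_n := S - S^T.
Definition kin_diag (S : 'M[C]_n) : 'cV[C]_n := \col_i S i i.
Definition kin_rowsum (S : 'M[C]_n) : 'cV[C]_n := \col_i \sum_(j | j != i) S i j.

Definition kin : {vspace 'M[C]_n} :=
  (lker (linfun kin_asym) :&: lker (linfun kin_diag)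
    :&: lker (linfun kin_rowsum))%VS.

Lemma kin_asym_linear : linear kin_asym.
Proof.
by move=> a S T; rewrite /kin_asym linearP/= opprD addrACA scalerBr.
Qed.
HB.instance Definition _ := GRing.isLinear.Build C _ _ _ kin_asym kin_asym_linear.

Lemma kin_diag_linear : linear kin_diag.
Proof. by move=> a S T; apply/colP=> i; rewrite !mxE. Qed.
HB.instance Definition _ := GRing.isLinear.Build C _ _ _ kin_diag kin_diag_linear.

Lemma kin_rowsum_linear : linear kin_rowsum.
Proof.
move=> a S T; apply/colP=> i; rewrite !mxE mulr_sumr -big_split.
by apply: eq_bigr => j _; rewrite !mxE.
Qed.
HB.instance Definition _ :=
  GRing.isLinear.Build C _ _ _ kin_rowsum kin_rowsum_linear.

Lemma kinP (S : 'M[C]_n) :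
  S \in kin <-> [/\ forall i j, S i j = S j i, forall i, S i i = 0
                  & forall i, \sum_(j | j != i) S i j = 0].
Proof.
have kerE m p (f : {linear 'M[C]_n -> 'M[C]_(m, p)}) :
    (S \in lker (linfun f)) = (f S == 0).
  by rewrite memv_ker lfunE.
have -> : (S \in kin) =
    (kin_asym S == 0) && (kin_diag S == 0) && (kin_rowsum S == 0).
  by rewrite /kin 2!memv_cap; congr (_ && _ && _); apply: kerE.
split.
  case/andP=> /andP[/eqP/matrixP h1 /eqP/colP h2] /eqP/colP h3.
  split=> [i j|i|i]; last 2 first.
  - by move: (h2 i); rewrite !mxE.
  - by move: (h3 i); rewrite !mxE.
  by apply/eqP; move: (h1 i j); rewrite !mxE => /eqP; rewrite subr_eq0.
case=> h1 h2 h3; apply/andP; split; first (apply/andP; split).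
- by apply/eqP/matrixP=> i j; rewrite !mxE h1 subrr.
- by apply/eqP/colP=> i; rewrite !mxE h2.
- by apply/eqP/colP=> i; rewrite !mxE h3.
Qed.

Definition kin_dual : Type := 'Hom(subvs_of kin, C^o).
HB.instance Definition _ := Vector.on kin_dual.

Definition kin_pairing (f : kin_dual) (s : subvs_of kin) : C :=
  (f : 'Hom(subvs_of kin, C^o)) s.

Lemma kin_pairingB f s t :
  kin_pairing f (s - t) = kin_pairing f s - kin_pairing f t.
Proof. by rewrite /kin_pairing linearB. Qed.

Definition kin_entry (i j : 'I_n) : kin_dual :=
  linfun (fun s : subvs_of kin => (vsval s i j : C^o)).

Lemma kin_entryE i j (s : subvs_of kin) :
  kin_pairing (kin_entry i j) s = vsval s i j.
Proof.
have hl : linear (fun s : subvs_of kin => (vsval s i j : C^o)).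
  by move=> a x y; rewrite linearP !mxE.
pose m := GRing.isLinear.Build C _ _ _ _ hl.
pose f : {linear subvs_of kin -> C^o} := HB.pack (fun s : subvs_of kin => (vsval s i j : C^o)) m.
exact: (lfunE f s).
Qed.

(* K_n^*(Z), the Z-span of the s_ij. *)
Definition kin_dualZ_pred : {pred kin_dual} :=
  fun f => `[< exists m : 'M[int]_n,
                 f = \sum_i \sum_j kin_entry i j *~ m i j >].

Lemma kin_dualZ_zmod_closed : zmod_closed kin_dualZ_pred.
Proof.
split=> [|f g /asboolP[a ->] /asboolP[b ->]]; apply/asboolP.
  by exists 0; rewrite big1 // => i _; rewrite big1 // => j _; rewrite mxE mulr0z.
exists (a - b); rewrite -sumrB; apply: eq_bigr => i _.
by rewrite -sumrB; apply: eq_bigr => j _; rewrite !mxE mulrzBr.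
Qed.

HB.instance Definition _ :=
  GRing.isZmodClosed.Build kin_dual kin_dualZ_pred kin_dualZ_zmod_closed.

Record kin_dualZ := KinDualZ {
  kin_dualZ_val :> kin_dual;
  _ : kin_dualZ_val \in kin_dualZ_pred }.

HB.instance Definition _ := [isSub for kin_dualZ_val].
HB.instance Definition _ := [Choice of kin_dualZ by <:].
HB.instance Definition _ := [SubChoice_isSubZmodule of kin_dualZ by <:].

(* K_n(Z), the points of K_n at which all of K_n^*(Z) is integral. *)
Definition kinZ_pred : {pred subvs_of kin} :=
  fun s => `[< forall f : kin_dualZ,
                 exists m : int, kin_pairing (kin_dualZ_val f) s = m%:~R >].

Lemma kinZ_zmod_closed : zmod_closed kinZ_pred.
Proof.
split=> [|s t /asboolP hs /asboolP ht]; apply/asboolP=> f.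
  by exists 0; rewrite /kin_pairing linear0.
have [a ha] := hs f; have [b hb] := ht f.
by exists (a - b); rewrite kin_pairingB ha hb rmorphB.
Qed.

HB.instance Definition _ :=
  GRing.isZmodClosed.Build (subvs_of kin) kinZ_pred kinZ_zmod_closed.

Record kinZ := KinZ {
  kinZ_val :> subvs_of kin;
  _ : kinZ_val \in kinZ_pred }.

HB.instance Definition _ := [isSub for kinZ_val].
HB.instance Definition _ := [Choice of kinZ by <:].
HB.instance Definition _ := [SubChoice_isSubZmodule of kinZ by <:].

Lemma kin_entry_dualZ i j : kin_entry i j \in kin_dualZ_pred.
Proof.
apply/asboolP; exists (delta_mx i j).
rewrite (bigD1 i) //= (bigD1 j) //= mxE !eqxx mulr1z.
rewrite big1 => [|k kj]; last by rewrite mxE (negPf kj) andbF mulr0z.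
rewrite big1 ?addr0 // => k ki.
by rewrite big1 // => l _; rewrite mxE (negPf ki) mulr0z.
Qed.

Lemma kinZ_entry_subproof (s : kinZ) (i j : 'I_n) :
  exists m : int, vsval (kinZ_val s) i j = m%:~R.
Proof.
case: s => s /= /asboolP /(_ (KinDualZ (kin_entry_dualZ i j))) [m] /=.
by rewrite kin_entryE => ->; exists m.
Qed.

Definition kinZ_entry (s : kinZ) (i j : 'I_n) : int :=
  sval (cid (kinZ_entry_subproof s i j)).

Lemma kinZ_entryE s i j : (kinZ_entry s i j)%:~R = vsval (kinZ_val s) i j.
Proof. by rewrite /kinZ_entry; case: cid => m /= ->. Qed.

End Moduli.

(* Main.v *)
Require Import Defs.
From HB Require Import structures.
From mathcomp Require Import all_boot all_order all_algebra.
From mathcomp Require Import complex.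
From mathcomp Require Import boolp functions reals.
From mathcomp Require Import mpoly.
From mathcomp Require Import ring.

(** The product prod_(i<j) (sigma_i - sigma_j)^(s_ij) extends to the product of
    the homogeneous minors p_ij = A_i0 A_j1 - A_i1 A_j0 with exponents s_ij.
    Rescaling the rows of A by t and acting by g multiplies p_ij by
    t_i t_j det g, so vanishing row sums make the product invariant
    ([prodlt_balanced]); this gives a homomorphism from K_n(Z) to the character
    lattice ([kin_char]).

    Injectivity.  If the product is constant, let one point z move among the
    others: prod_j (z - a_j)^(2 s_kj) is constant, hence all the exponents
    vanish ([prod_linear_const], [minor_prod_const]).

    Surjectivity.  In the affine chart of n finite points, a unit is a nowhere
    vanishing, locally rational function on the complement of the hyperplanes
    y_i = y_j, and such a function is a constant times a product of powers of
    the linear forms ([arrangement_unit]).  Instead of unique factorization in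
    several variables, the proof restricts the function to the line from a base
    point x to y.  There it is a one-variable fraction whose zeros and poles lie
    on the hyperplanes, so it is a product of powers of the linear forms
    ([same_order_factor], [unit_on_line]).  The exponents depend on y, but they
    are bounded by the degrees of one fixed fraction representing the function
    near x.  So finitely many polynomial identities cover all y, and one of them
    holds identically because a product of nonzero polynomial functions is
    nonzero ([meval_neq0M]).  Finally the invariance under
    sigma -> 1/sigma forces the row sums of the exponents to vanish
    ([affine_balanced]).

    Duality.  A functional f in K_n^*(Z) takes integral values on K_n(Z), hence
    defines a homomorphism on the character lattice.  Both injectivity and
    surjectivity of this map follow from an explicit family of integral points
    q_ij, for i < j < n - 1, such that every s in K_n is the sum of the
    s_ij q_ij ([kin_integral_basis]). *)

Set Implicit Arguments.
Unset Strict Implicit.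
Unset Printing Implicit Defensive.

Import GRing.Theory Num.Theory.
Local Open Scope ring_scope.
Local Open Scope quotient_scope.

(** * One-variable fractions with zeros and poles on given linear forms *)

Section SameOrder.
Variable F : closedFieldType.
Implicit Types (p q : {poly F}) (t : F).

(** Equality of the orders of vanishing of p and q at t, phrased as p / q
    having a representative p1 / q1 that is a unit at t: this is what local
    rationality of a unit provides directly, and it is stable under
    cancellation. *)
Definition same_order p q t : Prop :=
  exists p1 q1, [/\ ~~ root p1 t, ~~ root q1 t & p * q1 = p1 * q].

Lemma same_order_sym p q t : same_order p q t -> same_order q p t.
Proof.
by case=> p1 [q1 [h1 h2 E]]; exists q1, p1; rewrite h1 h2 mulrC -E mulrC.
Qed.

Lemma same_order_root p q t : same_order p q t -> root p t -> root q t.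
Proof.
case=> p1 [q1 [h1 h2 E]] /rootP pt; have := congr1 (horner^~ t) E.
rewrite !hornerM pt mul0r => /esym/eqP; rewrite mulf_eq0.
by case/orP=> // /idPn[].
Qed.

(** A factor vanishing at s is a unit at t, so it can be moved into q1. *)
Lemma same_orderMl p q s t : t != s ->
  same_order (p * ('X - s%:P)) q t -> same_order p q t.
Proof.
move=> ts [p1 [q1 [h1 h2 E]]]; exists p1, (('X - s%:P) * q1).
by rewrite mulrA; split=> //; rewrite rootM root_XsubC negb_or ts.
Qed.

Lemma same_orderMM p q r t : r != 0 ->
  same_order (p * r) (q * r) t -> same_order p q t.
Proof.
move=> r0 [p1 [q1 [h1 h2 E]]]; exists p1, q1; split=> //.
by apply: (mulfI r0); rewrite mulrA [r * p]mulrC E [RHS]mulrCA [q * r]mulrC.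
Qed.

Variables (K : finType) (l : K -> {poly F}).
Hypotheses (l0 : forall k, l k != 0) (l2 : forall k, (size (l k) <= 2)%N).

Lemma linear_root k t : root (l k) t ->
  exists2 c, c != 0 & l k = c *: ('X - t%:P).
Proof.
case/factor_theorem=> r E; have r0 : r != 0.
  by apply: contraNneq (l0 k) => r0; rewrite E r0 mul0r.
have /size_poly1P[c c0 rE] : size r == 1%N.
  rewrite eqn_leq size_poly_gt0 r0 andbT.
  by have := l2 k; rewrite E size_Mmonic ?monicXsubC // size_XsubC addn2 ltnS.
by exists c; rewrite // E rE mul_polyC.
Qed.

(** A root of p or q that is a root of no l k is common to both, and its linear
    factor cancels; the linear factor of any other root is, up to a constant,
    one of the l k.  Induction on the degrees removes the roots one at a time,
    which also bounds the exponents by the degrees: [arrangement_unit] needs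
    that bound. *)
Lemma same_order_factor p q : p != 0 -> q != 0 ->
    (forall t, (forall k, ~~ root (l k) t) -> same_order p q t) ->
  exists (c : F) (a b : K -> nat),
    [/\ c != 0, forall k, (a k < size p)%N, forall k, (b k < size q)%N
      & p * \prod_k l k ^+ b k = c *: (q * \prod_k l k ^+ a k)].
Proof.
have [m] := ubnP (size p + size q); elim: m p q => // m IH p q lepq p0 q0 pq.
have sz r t : r != 0 -> size (r * ('X - t%:P)) = (size r).+1.
  by move=> r0; rewrite size_Mmonic ?monicXsubC // size_XsubC addn2.
have nz r t : r * ('X - t%:P) != 0 -> r != 0.
  by apply: contraNneq => ->; rewrite mul0r.
have step p' q' : (size p' + size q' < m.+1)%N -> p' != 0 -> q' != 0 ->
    (forall t, (forall k, ~~ root (l k) t) -> same_order p' q' t) ->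
    size p' != 1%N ->
  exists (c : F) (a b : K -> nat),
    [/\ c != 0, forall k, (a k < size p')%N, forall k, (b k < size q')%N
      & p' * \prod_k l k ^+ b k = c *: (q' * \prod_k l k ^+ a k)].
- move=> {}lepq {}p0 {}q0 {}pq /closed_rootP[t pt].
  have [r pE] := factor_theorem _ _ pt; have r0 : r != 0.
    by apply: (nz r t); rewrite -pE.
  have [[k lkt]|nolt] := pselect (exists k, root (l k) t).
  + have [d d0 lkE] := linear_root lkt.
    have [|u ut|c [a [b [c0 ha hb E]]]] := IH r q' _ r0 q0.
    * by move: lepq; rewrite pE sz // addSn !ltnS.
    * have [uE|us] := eqVneq u t; first by have := ut k; rewrite uE lkt.
      by apply: (same_orderMl us); rewrite -pE; apply: pq.
    exists (c / d), (fun j => a j + (j == k))%N, b; split=> //.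
    * by rewrite mulf_neq0 ?invr_eq0.
    * by move=> j; rewrite pE sz // ltnS; case: eqP; rewrite ?addn1 ?addn0 // ltnW.
    under [in RHS]eq_bigr do rewrite exprD.
    rewrite big_split /= [X in _ * (_ * X)](bigD1 k) //= eqxx expr1.
    rewrite [X in _ * (_ * (_ * X))]big1 => [|j /negPf->]; last exact: expr0.
    rewrite mulr1.
    rewrite lkE pE mulrAC E -scalerAl -!scalerAr scalerA !mulrA.
    by rewrite divfK.
  + have out k : ~~ root (l k) t by apply/negP=> h; apply: nolt; exists k.
    have [s qE] := factor_theorem _ _ (same_order_root (pq t out) pt).
    have s0 : s != 0 by apply: (nz s t); rewrite -qE.
    have [|u ut|c [a [b [c0 ha hb E]]]] := IH r s _ r0 s0.
    * by move: lepq; rewrite pE qE !sz // addnS addSn !ltnS => /ltnW.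
    * apply: (@same_orderMM _ _ ('X - t%:P)); first by rewrite polyXsubC_eq0.
      by rewrite -pE -qE; apply: pq.
    exists c, a, b; split=> // [k|k|]; first by rewrite pE sz // ltnS ltnW.
      by rewrite qE sz // ltnS ltnW.
    by rewrite pE qE mulrAC E -scalerAl mulrAC.
have [p1|] := eqVneq (size p) 1%N; last exact: step.
have [q1|] := eqVneq (size q) 1%N; last first.
  move=> qn1; have [|t tl|c [a [b [c0 ha hb E]]]] := step q p _ q0 p0 _ qn1.
  - by rewrite addnC.
  - exact/same_order_sym/pq.
  exists c^-1, b, a; rewrite invr_eq0; split=> //.
  by rewrite E scalerA mulVf // scale1r.
case/eqP/size_poly1P: p1 => c c0 ->; case/eqP/size_poly1P: q1 => d d0 ->.
exists (c / d), (fun=> 0%N), (fun=> 0%N).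
rewrite mulf_neq0 ?invr_eq0 // !size_polyC c0 d0; split=> //.
by rewrite scalerAl -mul_polyC -polyCM divfK.
Qed.
End SameOrder.

Section Line.
Variables (F : closedFieldType) (n : nat).
Implicit Types (x y : 'I_n -> F) (P Q : {mpoly F[n]}).

Definition line_point x y (t : F) : 'I_n -> F := fun i => x i + t * (y i - x i).

Definition line_poly x y P : {poly F} :=
  mmap polyC (fun i => (x i)%:P + (y i - x i) *: 'X) P.

Lemma line_point0 x y : line_point x y 0 = x.
Proof. by apply: funext => i; rewrite /line_point mul0r addr0. Qed.

Lemma line_point1 x y : line_point x y 1 = y.
Proof. by apply: funext => i; rewrite /line_point mul1r addrC subrK. Qed.

Lemma horner_line_poly x y P t : (line_poly x y P).[t] = P.@[line_point x y t].
Proof.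
rewrite /line_poly /meval /mmap horner_sum; apply: eq_bigr => m _.
rewrite hornerM hornerC /mmap1 horner_prod; congr (_ * _); apply: eq_bigr => i _.
by rewrite horner_exp hornerD hornerC hornerZ hornerX mulrC.
Qed.

(** The bound does not depend on the line, whence the uniform bound on the
    exponents in [unit_on_line]. *)
Lemma size_line_poly x y P : (size (line_poly x y P) <= msize P)%N.
Proof.
apply: (leq_trans (size_sum _ _ _)); apply/bigmax_leqP_seq => m mP _.
apply: leq_trans (msize_mdeg_lt mP).
rewrite mul_polyC; apply: (leq_trans (size_scale_leq _ _)).
rewrite /mmap1 mdegE; elim/big_ind2: _ => [|p u q v pu qv|i _].
- by rewrite size_poly1.
- apply: (leq_trans (size_polyMleq _ _)).
  rewrite -subn1 leq_subLR; apply: (leq_trans (leq_add pu qv)).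
  by rewrite addSn addnS add1n.
- apply: (leq_trans (size_poly_exp_leq _ _)); rewrite ltnS -[leqRHS]mul1n leq_mul2r.
  apply/orP; right; rewrite -subn1 leq_subLR.
  apply: (leq_trans (size_polyD _ _)); rewrite geq_max.
  rewrite (leq_trans (size_polyC_leq1 _)) //.
  by rewrite (leq_trans (size_scale_leq _ _)) // size_polyX.
Qed.

Lemma line_poly0 x y P : P.@[x] != 0 -> line_poly x y P != 0.
Proof.
by apply: contraNneq => E; rewrite -(line_point0 x y) -horner_line_poly E horner0.
Qed.

Lemma line_poly1 x y P : P.@[y] != 0 -> line_poly x y P != 0.
Proof.
by apply: contraNneq => E; rewrite -(line_point1 x y) -horner_line_poly E horner0.
Qed.

(** The ring of polynomial functions is a domain: on the line from x to y both
    functions are nonzero one-variable polynomials, so they have a common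
    nonroot. *)
Lemma meval_neq0M x y P Q : P.@[x] != 0 -> Q.@[y] != 0 ->
  exists z, P.@[z] != 0 /\ Q.@[z] != 0.
Proof.
move=> Px Qy; have : line_poly x y P * line_poly x y Q != 0.
  by apply: mulf_neq0; [apply: line_poly0|apply: line_poly1].
case/closed_nonrootP=> t; rewrite rootM negb_or /root !horner_line_poly => /andP[].
by exists (line_point x y t).
Qed.

Lemma meval_neq0_prod (I : finType) (G : I -> {mpoly F[n]}) :
    (forall i, exists x, (G i).@[x] != 0) ->
  exists x, (\prod_i G i).@[x] != 0.
Proof.
move=> h; elim/big_ind: _ => [|P Q [x Px] [y Qy]|i _ //].
  by exists (fun=> 0); rewrite meval1 oner_neq0.
by have [z [Pz Qz]] := meval_neq0M Px Qy; exists z; rewrite mevalM mulf_neq0.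
Qed.

End Line.

(** * Units on the complement of a hyperplane arrangement *)

Section Arrangement.
Variables (F : closedFieldType) (n : nat) (K : finType) (L : K -> {mpoly F[n]}).
Hypothesis L2 : forall k, (msize (L k) <= 2)%N.
Implicit Types (x y : 'I_n -> F) (f : ('I_n -> F) -> F).

Definition arr_compl x : Prop := forall k, (L k).@[x] != 0.

Definition represents f (P Q : {mpoly F[n]}) : Prop :=
  forall y, arr_compl y -> Q.@[y] != 0 -> f y = P.@[y] / Q.@[y].

Definition loc_rational f : Prop := forall x, arr_compl x ->
  exists P Q, Q.@[x] != 0 /\ represents f P Q.

Definition arr_monomial (a : K -> nat) : {mpoly F[n]} := \prod_k L k ^+ a k.

Lemma meval_arr_monomial a x : (arr_monomial a).@[x] = \prod_k (L k).@[x] ^+ a k.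
Proof. by rewrite rmorph_prod; apply: eq_bigr => k _; rewrite rmorphXn. Qed.

Lemma arr_monomial_neq0 a x : arr_compl x -> (arr_monomial a).@[x] != 0.
Proof.
move=> Ux; rewrite meval_arr_monomial; apply/prodf_neq0=> k _.
by rewrite expf_neq0.
Qed.

Lemma represents_mul f P Q y : represents f P Q -> arr_compl y ->
  Q.@[y] != 0 -> P.@[y] = f y * Q.@[y].
Proof. by move=> h Uy Qy; rewrite h // divfK. Qed.

Variable f : ('I_n -> F) -> F.
Hypotheses (f_rat : loc_rational f) (f_unit : forall y, arr_compl y -> f y != 0).

(** Two fractions that represent f agree at all but finitely many points of the
    line, so they are equal as one-variable fractions. *)
Lemma represents_line_cross x y P Q P1 Q1 : arr_compl x ->
    represents f P Q -> represents f P1 Q1 ->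
    line_poly x y Q != 0 -> line_poly x y Q1 != 0 ->
  line_poly x y P * line_poly x y Q1 = line_poly x y P1 * line_poly x y Q.
Proof.
move=> Ux PQ PQ1 Q0 Q10; apply/eqP; rewrite -subr_eq0; apply/contraT => D0.
have lL0 : \prod_k line_poly x y (L k) != 0.
  by apply/prodf_neq0=> k _; apply: line_poly0.
set D := (X in X != 0) in D0.
have /closed_nonrootP[t] : D * (line_poly x y Q * line_poly x y Q1)
    * \prod_k line_poly x y (L k) != 0 by rewrite !mulf_neq0.
rewrite /root !hornerM !mulf_eq0 !negb_or horner_prod !horner_line_poly.
case/andP=> /andP[Dt /andP[Qt Q1t]] /prodf_neq0 Ut.
have {}Ut : arr_compl (line_point x y t).
  by move=> k; rewrite -horner_line_poly; apply: Ut.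
case/negP: Dt; rewrite /D !hornerE !horner_line_poly.
by rewrite (represents_mul PQ) // (represents_mul PQ1) // mulrAC subrr.
Qed.

(** On the line from x to y, f is a fraction whose zeros and poles lie on the
    hyperplanes, hence a product of powers of the L k.  Comparing its values at
    x and y, with denominators cleared, gives the identity. *)
Lemma unit_on_line x y P Q : arr_compl x -> arr_compl y ->
    Q.@[x] != 0 -> represents f P Q ->
  exists a b : K -> nat,
    [/\ forall k, (a k < msize P)%N, forall k, (b k < msize Q)%N
      & f y * (arr_monomial b).@[y] * (arr_monomial a).@[x] =
        f x * (arr_monomial b).@[x] * (arr_monomial a).@[y]].
Proof.
move=> Ux Uy Qx PQ.
have Px : P.@[x] != 0 by rewrite (represents_mul PQ) // mulf_neq0 ?f_unit.
have [|||||c [a [b [c0 ha hb E]]]] :=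
    @same_order_factor _ _ (fun k => line_poly x y (L k)) _ _
      (line_poly x y P) (line_poly x y Q).
- by move=> k; apply: line_poly0.
- by move=> k; apply: leq_trans (size_line_poly _ _ _) _.
- exact: line_poly0.
- exact: line_poly0.
- move=> t Ut; have {}Ut : arr_compl (line_point x y t).
    by move=> k; rewrite -horner_line_poly; apply: Ut.
  have [P1 [Q1 [Q1t PQ1]]] := f_rat Ut.
  exists (line_poly x y P1), (line_poly x y Q1); rewrite /root !horner_line_poly.
  split=> //; first by rewrite (represents_mul PQ1) // mulf_neq0 ?f_unit.
  apply: represents_line_cross => //; first exact: line_poly0.
  by apply: contraNneq Q1t => E; rewrite -horner_line_poly E horner0.
have key t : arr_compl (line_point x y t) ->
    f (line_point x y t) * (arr_monomial b).@[line_point x y t] =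
    c * (arr_monomial a).@[line_point x y t].
  move=> Ut; have [P1 [Q1 [Q1t PQ1]]] := f_rat Ut.
  have Q10 : line_poly x y Q1 != 0.
    by apply: contraNneq Q1t => E1; rewrite -horner_line_poly E1 horner0.
  have C := represents_line_cross Ux PQ PQ1 (line_poly0 y Qx) Q10.
  have {}E : line_poly x y P1 * \prod_k line_poly x y (L k) ^+ b k =
             c *: (line_poly x y Q1 * \prod_k line_poly x y (L k) ^+ a k).
    apply: (mulfI (line_poly0 y Qx)).
    rewrite mulrA [_ * line_poly x y P1]mulrC -C mulrAC E -!scalerAr -scalerAl.
    by rewrite mulrA mulrAC -mulrA mulrCA.
  have := congr1 (horner^~ t) E; rewrite hornerZ !hornerM !horner_prod.
  have S d : \prod_k (line_poly x y (L k) ^+ d k).[t] =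
      (arr_monomial d).@[line_point x y t].
    rewrite meval_arr_monomial; apply: eq_bigr => k _.
    by rewrite horner_exp horner_line_poly.
  rewrite !S !horner_line_poly (represents_mul PQ1) // => {}E.
  by apply: (mulfI Q1t); rewrite mulrA [_ * f _]mulrC E mulrCA.
exists a, b; split=> [k|k|].
- exact: leq_trans (ha k) (size_line_poly _ _ _).
- exact: leq_trans (hb k) (size_line_poly _ _ _).
have := key 1; have := key 0; rewrite line_point0 line_point1.
by move=> -> // -> //; rewrite mulrAC.
Qed.

(** The polynomial in y expressing the identity of [unit_on_line] with f
    replaced by the fraction P / Q and its denominator cleared. *)
Definition cleared x (a b : K -> nat) (P Q : {mpoly F[n]}) : {mpoly F[n]} :=
  P * arr_monomial b * (arr_monomial a).@[x]%:MP
  - Q * (f x * (arr_monomial b).@[x])%:MP * arr_monomial a.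

Lemma meval_cleared x y a b P Q : represents f P Q -> arr_compl y ->
    Q.@[y] != 0 ->
  ((cleared x a b P Q).@[y] == 0) =
  (f y * (arr_monomial b).@[y] * (arr_monomial a).@[x] ==
   f x * (arr_monomial b).@[x] * (arr_monomial a).@[y]).
Proof.
move=> PQ Uy Qy; rewrite mevalB !mevalM !mevalC (represents_mul PQ) // subr_eq0.
by rewrite ![_ * Q.@[y]]mulrC -!(mulrA Q.@[y]) (inj_eq (mulfI Qy)).
Qed.

(** The exponents given by [unit_on_line] are bounded independently of y, so
    finitely many polynomials [cleared] have a product that vanishes on a dense
    set.  One of them must then vanish identically. *)
Theorem arrangement_unit x : arr_compl x ->
  exists (c : F) (e : K -> int), c != 0 /\
    forall y, arr_compl y -> f y = c * \prod_k (L k).@[y] ^ e k.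
Proof.
move=> Ux; have [P [Q [Qx PQ]]] := f_rat Ux.
have U1 := arr_monomial_neq0 (fun=> 1%N) Ux.
have Uof z : (arr_monomial (fun=> 1%N)).@[z] != 0 -> arr_compl z.
  by rewrite meval_arr_monomial => /prodf_neq0 h k; have := h k isT; rewrite expr1.
have [a [b Gab]] : exists a b, forall y, (cleared x a b P Q).@[y] = 0.
  (* Only finitely many exponents are possible on lines through x; if none of
     them worked everywhere, some y in the complement would refute them all. *)
  pose G (ab : {ffun K -> 'I_(msize P)} * {ffun K -> 'I_(msize Q)}) :=
    cleared x (fun k => ab.1 k) (fun k => ab.2 k) P Q.
  suff [ab Gab] : exists ab, forall y, (G ab).@[y] = 0.
    by exists (fun k => ab.1 k), (fun k => ab.2 k).
  apply/not_existsP => noab.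
  have [|y Gy] := @meval_neq0_prod _ _ _ G.
    by move=> ab; have /existsNP[y /eqP] := noab ab; exists y.
  have [z [Gz]] : exists z, (\prod_ab G ab).@[z] != 0 /\
      (Q * arr_monomial (fun=> 1%N)).@[z] != 0.
    by apply: (meval_neq0M Gy (y := x)); rewrite mevalM mulf_neq0.
  rewrite mevalM mulf_eq0 negb_or => /andP[Qz /Uof Uz].
  have [a [b [ha hb E]]] := unit_on_line Ux Uz Qx PQ.
  move: Gz; rewrite rmorph_prod => /prodf_neq0.
  move=> /(_ ([ffun k => Ordinal (ha k)], [ffun k => Ordinal (hb k)]) isT).
  rewrite meval_cleared // /=.
  have -> : (fun k => [ffun k => Ordinal (ha k)] k : nat) = a.
    by apply: funext => k; rewrite ffunE.
  have -> : (fun k => [ffun k => Ordinal (hb k)] k : nat) = b.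
    by apply: funext => k; rewrite ffunE.
  by rewrite E eqxx.
have main y : arr_compl y ->
    f y * (arr_monomial b).@[y] * (arr_monomial a).@[x] =
    f x * (arr_monomial b).@[x] * (arr_monomial a).@[y].
  (* Q may vanish at y, so the identity is carried over, by density, to a
     fraction whose denominator does not. *)
  move=> Uy; have [P1 [Q1 [Q1y PQ1]]] := f_rat Uy.
  apply/eqP; rewrite -(meval_cleared x a b PQ1) //; apply/contraT => Hy.
  have [z []] : exists z, (cleared x a b P1 Q1 * Q1).@[z] != 0 /\
      (Q * arr_monomial (fun=> 1%N)).@[z] != 0.
    by apply: (meval_neq0M (x := y) (y := x)); rewrite mevalM mulf_neq0.
  rewrite !mevalM !mulf_eq0 !negb_or => /andP[Hz Q1z] /andP[Qz /Uof Uz].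
  have := Gab z => /eqP.
  by rewrite (meval_cleared x a b PQ) // -(meval_cleared x a b PQ1) // (negPf Hz).
exists (f x * (arr_monomial b).@[x] / (arr_monomial a).@[x]),
  (fun k => (a k)%:Z - (b k)%:Z).
split; first by rewrite !mulf_neq0 ?invr_eq0 ?f_unit ?arr_monomial_neq0.
move=> y Uy.
have -> : \prod_k (L k).@[y] ^ ((a k)%:Z - (b k)%:Z) =
    (arr_monomial a).@[y] / (arr_monomial b).@[y].
  rewrite !meval_arr_monomial -prodf_div; apply: eq_bigr => k _.
  by rewrite expfzDr // exprnN.
rewrite mulf_div -main // -mulrA [X in _ / X]mulrC mulfK //.
by rewrite mulf_neq0 ?arr_monomial_neq0.
Qed.

End Arrangement.

(** * Products over pairs of indices and minors of configurations *)

(** Turns products over pairs i < j into products over all rows, which is how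
    row sums enter. *)
Lemma big_ltn_pair (T : Type) (idx : T) (op : Monoid.com_law idx) (n : nat)
    (G : 'I_n -> 'I_n -> T) :
  \big[op/idx]_(i < n) \big[op/idx]_(j < n | (i < j)%N) op (G i j) (G j i) =
  \big[op/idx]_(i < n) \big[op/idx]_(j < n | j != i) G i j.
Proof.
under eq_bigr do rewrite big_split.
rewrite big_split /= [X in op _ X](exchange_big_dep xpredT) //= -big_split /=.
apply: eq_bigr => i _; rewrite [RHS](bigID (fun j : 'I_n => (i < j)%N)) /=.
by congr (op _ _); apply: eq_bigl => j; rewrite -(inj_eq val_inj) /=;
  case: ltngtP.
Qed.

Lemma prodr_exp_sum (F : fieldType) (I : Type) (r : seq I) (P : pred I)
    (x : F) (e : I -> int) : x != 0 ->
  \prod_(i <- r | P i) x ^ e i = x ^ (\sum_(i <- r | P i) e i).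
Proof.
move=> x0; elim/big_rec2: _ => [|i m y _ ->]; first by rewrite expr0z.
by rewrite expfzDr.
Qed.

Definition pos_part (e : int) : nat := if e is Posz m then m else 0%N.
Definition neg_part (e : int) : nat := if e is Negz m then m.+1 else 0%N.

Lemma exprz_parts (F : fieldType) (x : F) e :
  x ^ e = x ^+ pos_part e / x ^+ neg_part e.
Proof. by case: e => m /=; rewrite ?expr0 ?divr1 ?div1r. Qed.

Lemma pos_part_sub_neg_part e : (pos_part e)%:Z - (neg_part e)%:Z = e.
Proof. by case: e => m /=; rewrite ?subr0 // NegzE sub0r. Qed.

Lemma pos_part_eq0 e : (pos_part e == 0%N) || (neg_part e == 0%N).
Proof. by case: e => m /=; rewrite ?eqxx ?orbT. Qed.

(** Once the negative powers are moved to the other side, this is an identity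
    of polynomials; evaluated at a_i, only one side would vanish if e_i were
    nonzero. *)
Lemma prod_linear_const (F : closedFieldType) (I : finType) (a : I -> F)
    (e : I -> int) (c : F) : injective a ->
    (forall z, (forall i, z != a i) -> \prod_i (z - a i) ^ e i = c) ->
  forall i, e i = 0.
Proof.
move=> a_inj ha i.
pose p := \prod_j ('X - (a j)%:P) ^+ pos_part (e j).
pose q := \prod_j ('X - (a j)%:P) ^+ neg_part (e j).
have hE (d : I -> nat) z :
    (\prod_j ('X - (a j)%:P) ^+ d j).[z] = \prod_j (z - a j) ^+ d j.
  by rewrite horner_prod; apply: eq_bigr => j _; rewrite horner_exp hornerXsubC.
have r0 (d : I -> nat) : (\prod_j (a i - a j) ^+ d j == 0) -> (0 < d i)%N.
  by case/prodf_eq0 => k _; rewrite expf_eq0 subr_eq0 => /andP[dk /eqP/a_inj->].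
have r1 (d : I -> nat) : (0 < d i)%N -> \prod_j (a i - a j) ^+ d j = 0.
  by move=> di; rewrite (bigD1 i) //= subrr expr0n gtn_eqF // mul0r.
have pq z : (forall j, z != a j) -> p.[z] = c * q.[z].
  move=> za; rewrite -(ha _ za) !hE -big_split; apply: eq_bigr => j _.
  by rewrite /= exprz_parts divfK // expf_neq0 // subr_eq0.
have E : p = c *: q.
  apply/eqP; rewrite -subr_eq0; apply/contraT => D0.
  have /closed_nonrootP[z] : (p - c *: q) * \prod_j ('X - (a j)%:P) != 0.
    by rewrite mulf_neq0 //; apply/prodf_neq0 => j _; rewrite polyXsubC_eq0.
  rewrite rootM negb_or /root horner_prod => /andP[/negP Dz /prodf_neq0 za].
  case: Dz; rewrite !hornerE pq ?subrr // => j.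
  by have := za j isT; rewrite hornerXsubC subr_eq0.
have c0 : c != 0.
  have : p != 0 by apply/prodf_neq0 => j _; rewrite expf_neq0 ?polyXsubC_eq0.
  by rewrite E scaler_eq0 negb_or => /andP[].
have := congr1 (horner^~ (a i)) E; rewrite hornerZ !hE => {}E.
have [P0|P0] := posnP (pos_part (e i)); last first.
  move: (E); rewrite r1 // => /esym/eqP; rewrite mulf_eq0 (negPf c0) /=.
  move/(r0 (fun j => neg_part (e j))); have := pos_part_eq0 (e i).
  by rewrite (gtn_eqF P0) => /eqP->.
have [N0|N0] := posnP (neg_part (e i)).
  by rewrite -(pos_part_sub_neg_part (e i)) P0 N0.
move/eqP: E; rewrite [X in _ * X]r1 // mulr0.
by move/(r0 (fun j => pos_part (e j))); rewrite P0.
Qed.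

Section ProdLt.
Variables (F : fieldType) (n : nat).
Implicit Types (u v : 'I_n -> 'I_n -> F) (s : 'I_n -> 'I_n -> int) (t : 'I_n -> F).

Definition prodlt u s : F := \prod_(i < n) \prod_(j < n | (i < j)%N) u i j ^ s i j.

Definition rowsum s (i : 'I_n) : int := \sum_(j | j != i) s i j.

Definition balanced s : Prop :=
  (forall i j, s i j = s j i) /\ forall i, rowsum s i = 0.

Lemma eq_prodlt u v s r :
  (forall i j : 'I_n, (i < j)%N -> u i j = v i j) ->
  (forall i j : 'I_n, (i < j)%N -> s i j = r i j) ->
  prodlt u s = prodlt v r.
Proof.
by move=> uv sr; apply: eq_bigr => i _; apply: eq_bigr => j ij; rewrite uv // sr.
Qed.

Lemma prodlt_neq0 u s :
  (forall i j : 'I_n, (i < j)%N -> u i j != 0) -> prodlt u s != 0.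
Proof.
move=> u0; apply/prodf_neq0 => i _; apply/prodf_neq0 => j ij.
by rewrite expfz_neq0 ?u0.
Qed.

Lemma prodltD u s r : (forall i j : 'I_n, (i < j)%N -> u i j != 0) ->
  prodlt u (fun i j => s i j + r i j) = prodlt u s * prodlt u r.
Proof.
move=> u0; rewrite /prodlt -big_split; apply: eq_bigr => i _ /=.
by rewrite -big_split; apply: eq_bigr => j ij; rewrite /= expfzDr ?u0.
Qed.

(** The factor t_i occurs once for each pair that contains i, hence to the
    power [rowsum s i]. *)
Lemma prodlt_scale u v s t d : d != 0 -> (forall i, t i != 0) ->
    (forall i j, s i j = s j i) ->
    (forall i j : 'I_n, (i < j)%N -> u i j = t i * t j * d * v i j) ->
  prodlt u s = (\prod_i t i ^ rowsum s i)
     * d ^ (\sum_(i < n) \sum_(j < n | (i < j)%N) s i j) * prodlt v s.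
Proof.
move=> d0 t0 sC uE.
have -> : \prod_i t i ^ rowsum s i =
    \prod_(i < n) \prod_(j < n | (i < j)%N) (t i * t j) ^ s i j.
  under [RHS]eq_bigr => i _ do under eq_bigr => j _ do rewrite expfzMl {2}sC.
  rewrite (big_ltn_pair _ (fun i j => t i ^ s i j)).
  by apply: eq_bigr => i _; rewrite prodr_exp_sum.
rewrite -prodr_exp_sum // /prodlt -!big_split; apply: eq_bigr => i _ /=.
rewrite -prodr_exp_sum // -!big_split; apply: eq_bigr => j ij /=.
by rewrite uE // !expfzMl.
Qed.

(** Twice the total is the sum of all the row sums. *)
Lemma balanced_total s : balanced s ->
  \sum_(i < n) \sum_(j < n | (i < j)%N) s i j = 0.
Proof.
case=> sC s0; set S := (X in X = 0).
suff /eqP : S *+ 2 = 0 by rewrite mulrn_eq0 => /eqP.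
rewrite mulr2n /S -big_split /=.
under eq_bigr => i _ do rewrite -big_split /=.
under eq_bigr => i _ do under eq_bigr => j _ do rewrite {2}sC.
by rewrite (big_ltn_pair _ (fun i j => s i j)) big1 // => i _; apply: s0.
Qed.

Lemma prodlt_balanced u v s t d : d != 0 -> (forall i, t i != 0) -> balanced s ->
    (forall i j : 'I_n, (i < j)%N -> u i j = t i * t j * d * v i j) ->
  prodlt u s = prodlt v s.
Proof.
move=> d0 t0 bs uE; rewrite (prodlt_scale d0 t0 bs.1 uE).
rewrite (balanced_total bs) expr0z mulr1 big1 ?mul1r // => i _.
by rewrite bs.2 expr0z.
Qed.
End ProdLt.

Section Moduli.
Variables (R : realType) (n : nat).
Local Notation C := R[i].
Local Notation point := ('I_n -> C).
Implicit Types (s : 'I_n -> 'I_n -> int) (A B : conf R n) (y : point).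

Definition minor (A : 'M[C]_(n, 2)) (i j : 'I_n) : C :=
  A i 0 * A j 1 - A i 1 * A j 0.

Lemma conf_minor A i j : i != j -> minor A i j != 0.
Proof. by move: (valP A) => /andP[_ /forallP/(_ i)/forallP/(_ j)/implyP]. Qed.

Lemma conf_minor_lt A (i j : 'I_n) : (i < j)%N -> minor A i j != 0.
Proof. by move=> ij; apply: conf_minor; rewrite neq_ltn ij. Qed.

Lemma ord2_01 (k : 'I_2) : k = 0 \/ k = 1.
Proof. by case: k => -[|[|]] // p; [left|right]; apply: val_inj. Qed.

Lemma minor_equiv (t : 'rV[C]_n) (g : 'M[C]_2) (A B : 'M[C]_(n, 2)) i j :
  B = diag_mx t *m A *m g ->
  minor B i j = t 0 i * t 0 j * (g 0 0 * g 1 1 - g 0 1 * g 1 0) * minor A i j.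
Proof.
move=> ->; have E k l :
    (diag_mx t *m A *m g) k l = t 0 k * (A k 0 * g 0 l + A k 1 * g 1 l).
  rewrite -mulmxA mul_diag_mx !mxE !big_ord_recl big_ord0 addr0.
  by congr (_ * (A _ _ * g _ _ + A _ _ * g _ _)); apply: val_inj.
by rewrite /minor !E; ring.
Qed.

Definition minor_prod s (A : 'M[C]_(n, 2)) : C := prodlt (minor A) s.

Lemma minor_prod_equiv s A B :
  balanced s -> pgl_equiv A B -> minor_prod s A = minor_prod s B.
Proof.
move=> bs /asboolP[t [g [t0 _ E]]]; apply/esym.
have [n1|n1] := leqP n 1.
  rewrite /minor_prod /prodlt !big1 // => i _; rewrite big1 // => j;
    by rewrite ltnNge -ltnS (leq_trans (ltn_ord j)) // (leq_trans n1).
pose i0 := Ordinal (ltnW n1); pose i1 := Ordinal n1.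
have EB i j := minor_equiv i j E.
apply: (prodlt_balanced _ t0 bs (fun i j _ => EB i j)).
have : minor B i0 i1 != 0 by apply: conf_minor_lt.
by rewrite EB; apply: contraNneq => ->; rewrite mulr0 mul0r.
Qed.

End Moduli.

(** * Regularity of the products of minors, and the affine chart *)

Section Moduli.
Variables (R : realType) (n : nat).
Local Notation C := R[i].
Local Notation point := ('I_n -> C).
Implicit Types (s : 'I_n -> 'I_n -> int) (A B : conf R n) (y : point).

Lemma M0n_class_eq A B : (M0n_class A == M0n_class B) = pgl_equiv A B.
Proof. by rewrite /M0n_class eqmodE. Qed.

Lemma M0n_classP (x : M0n R n) : exists A, x = M0n_class A.
Proof. by exists (repr x); rewrite /M0n_class reprK. Qed.

Definition affmx y : 'M[C]_(n, 2) := \matrix_(i, k) (if k == 0 then y i else 1).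

Lemma minor_affmx y i j : minor (affmx y) i j = y i - y j.
Proof. by rewrite /minor !mxE /= mulr1 mul1r. Qed.

Lemma is_conf_affmx y : is_conf (affmx y) = injectiveb y.
Proof.
apply/andP/injectiveP => [[_ h] i j yij|y_inj].
  apply/eqP/contraT => ij; have := forallP (forallP h i) j.
  by rewrite ij -/(minor _ i j) minor_affmx yij subrr eqxx.
split; apply/forallP => i.
  by apply/eqP => /rowP/(_ 1); rewrite !mxE /=; apply/eqP/oner_neq0.
apply/forallP => j; apply/implyP => ij.
by rewrite -/(minor _ i j) minor_affmx subr_eq0 (inj_eq y_inj).
Qed.

Definition aff_conf y (y_inj : injective y) : conf R n :=
  Conf (etrans (is_conf_affmx y) (introT (injectiveP y) y_inj)).

Lemma minor_sigma A i j : A i 1 != 0 -> A j 1 != 0 ->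
  minor A i j = A i 1 * A j 1 * (sigma A i - sigma A j).
Proof. by move=> Ai Aj; rewrite /minor /sigma; field; rewrite Ai Aj. Qed.

Lemma minor_prod_sigma s A : balanced s -> (forall i, A i 1 != 0) ->
  minor_prod s A = prodlt (fun i j => sigma A i - sigma A j) s.
Proof.
move=> bs A1; apply: (prodlt_balanced (oner_neq0 _) A1 bs) => i j _.
by rewrite minor_sigma // mulr1.
Qed.

(** A projective change of coordinates moves all the points away from infinity:
    the point -1/a that it sends to infinity is chosen outside the
    configuration, and then each row is rescaled to have last coordinate 1. *)
Lemma exists_affine (A : conf R n) :
  exists y (y_inj : injective y), M0n_class A = M0n_class (aff_conf y_inj).
Proof.
have /closed_nonrootP[a] : \prod_i ((A i 1)%:P + (A i 0) *: 'X) != 0 :> {poly C}.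
  apply/prodf_neq0 => i _; move: (valP A) => /andP[/forallP/(_ i) + _].
  apply: contraNneq => E; apply/eqP/rowP => k; rewrite !mxE.
  case: (ord2_01 k) => ->.
    by have := congr1 (coefp 1) E; rewrite /= !coefE /= mulr1 add0r.
  by have := congr1 (coefp 0) E; rewrite /= !coefE /= mulr0 addr0.
rewrite /root horner_prod => /prodf_neq0 ha.
pose d i := A i 1 + A i 0 * a.
have d0 i : d i != 0 by have := ha i isT; rewrite !hornerE.
pose y i := A i 0 / d i.
pose g : 'M[C]_2 := \matrix_(i, j) (if (i == 0) && (j == 1) then a else (i == j)%:R).
have gU : g \in unitmx.
  rewrite unitmxE unitfE (expand_det_col _ 0) !big_ord_recl big_ord0.
  rewrite /cofactor !det_mx11 !mxE /=.
  by rewrite expr0 !mulr1 mul0r !addr0 oner_neq0.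
have E : affmx y = diag_mx (\row_i (d i)^-1) *m A *m g.
  apply/matrixP => i k; rewrite -mulmxA mul_diag_mx !mxE.
  rewrite !big_ord_recl big_ord0 addr0 !mxE.
  have -> : lift ord0 ord0 = 1 :> 'I_2 by apply: val_inj.
  have -> : ord0 = 0 :> 'I_2 by apply: val_inj.
  case: (ord2_01 k) => -> /=; first by rewrite mulr1 mulr0 addr0 mulrC.
  by rewrite mulr1 addrC mulVf.
have t0 i : (\row_i (d i)^-1) 0 i != 0 by rewrite mxE invr_eq0.
have y_inj : injective y.
  move=> i j yij; apply/eqP/contraT => ij; have := conf_minor A ij.
  have : minor (affmx y) i j = 0 by rewrite minor_affmx yij subrr.
  rewrite (minor_equiv _ _ E) => /eqP.
  rewrite !mulf_eq0 (negPf (t0 i)) (negPf (t0 j)) /=.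
  by rewrite !mxE /= mulr0 subr0 mulr1 oner_eq0 /= => ->.
exists y, y_inj; apply/eqP; rewrite M0n_class_eq; apply/asboolP.
by exists (\row_i (d i)^-1), g; split.
Qed.

Definition minor_poly (i j : 'I_n) : {mpoly C[n * 2]} :=
  'X_(mxvec_index i 0) * 'X_(mxvec_index j 1)
  - 'X_(mxvec_index i 1) * 'X_(mxvec_index j 0).

Lemma conf_eval_minor i j A : conf_eval (minor_poly i j) A = minor A i j.
Proof. by rewrite /conf_eval mevalB !mevalM !mevalXU !mxvecE. Qed.

Lemma mxvec_index_eq i j (k l : 'I_2) :
  (mxvec_index i k == mxvec_index j l :> 'I_(n * 2)) = (i == j) && (k == l).
Proof.
have := mxvecE (delta_mx i k : 'M[C]_(n, 2)) j l.
rewrite mxvec_delta !mxE eqxx /= eq_sym [j == i]eq_sym [l == k]eq_sym.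
by move=> /eqP; rewrite eqr_nat => /eqP; case: eqP; case: (_ && _).
Qed.

Lemma multihomog_var i k :
  multihomog (fun r => nat_of_bool (r == i))
    ('X_(mxvec_index i k) : {mpoly C[n * 2]}).
Proof.
move=> m; rewrite msuppX inE => /eqP-> r; rewrite !mnm1E !mxvec_index_eq eq_sym.
by case: (ord2_01 k) => ->; case: eqP.
Qed.

Lemma multihomog_minor i j :
  multihomog (fun k => (k == i) + (k == j))%N (minor_poly i j).
Proof.
apply: multihomogB; first by apply: multihomogM; apply: multihomog_var.
by apply: multihomogM; apply: multihomog_var.
Qed.

Lemma multihomog1 : multihomog (fun=> 0%N) (1 : {mpoly C[n * 2]}).
Proof. by move=> m; rewrite msupp1 inE => /eqP-> i; rewrite !mnmE. Qed.

Lemma multihomogX d (P : {mpoly C[n * 2]}) e : multihomog d P ->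
  multihomog (fun k => d k * e)%N (P ^+ e).
Proof.
move=> hP; elim: e => [|e IH].
  rewrite expr0 (_ : (fun k => _) = fun=> 0%N); first exact: multihomog1.
  by apply: funext => k; rewrite muln0.
rewrite exprS (_ : (fun k => _) = fun k => (d k + d k * e)%N).
  exact: multihomogM.
by apply: funext => k; rewrite mulnS.
Qed.

Lemma multihomog_prod (I : Type) (r : seq I) (p : pred I) (d : I -> 'I_n -> nat)
    (P : I -> {mpoly C[n * 2]}) :
  (forall i, multihomog (d i) (P i)) ->
  multihomog (fun k => \sum_(i <- r | p i) d i k)%N (\prod_(i <- r | p i) P i).
Proof.
move=> h; elim: r => [|i r IH].
  rewrite big_nil (_ : (fun k => _) = fun=> 0%N); first exact: multihomog1.
  by apply: funext => k; rewrite big_nil.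
rewrite big_cons (_ : (fun k => _) = fun k =>
    if p i then (d i k + \sum_(j <- r | p j) d j k)%N
    else (\sum_(j <- r | p j) d j k)%N).
  by case: (p i) => //; apply: multihomogM.
by apply: funext => k; rewrite big_cons.
Qed.

Definition minor_monomial (a : 'I_n -> 'I_n -> nat) : {mpoly C[n * 2]} :=
  \prod_(i < n) \prod_(j < n | (i < j)%N) minor_poly i j ^+ a i j.

Definition minor_multideg (a : 'I_n -> 'I_n -> nat) (k : 'I_n) : nat :=
  (\sum_(i < n) \sum_(j < n | (i < j)%N) ((k == i) + (k == j)) * a i j)%N.

Lemma multihomog_minor_monomial a : multihomog (minor_multideg a) (minor_monomial a).
Proof.
apply: multihomog_prod => i; apply: multihomog_prod => j.
by apply: multihomogX; apply: multihomog_minor.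
Qed.

Lemma conf_eval_minor_monomial a A : conf_eval (minor_monomial a) A =
  \prod_(i < n) \prod_(j < n | (i < j)%N) minor A i j ^+ a i j.
Proof.
rewrite /conf_eval rmorph_prod; apply: eq_bigr => i _; rewrite rmorph_prod.
by apply: eq_bigr => j _; rewrite rmorphXn /= -conf_eval_minor.
Qed.

Lemma minor_multidegE (a : 'I_n -> 'I_n -> nat) k :
  (forall i j, a i j = a j i) ->
  minor_multideg a k = (\sum_(j < n | j != k) a k j)%N.
Proof.
move=> aC; rewrite /minor_multideg.
under eq_bigr => i _ do under eq_bigr => j _ do rewrite mulnDl {2}aC.
rewrite (big_ltn_pair _ (fun i j => ((k == i) * a i j)%N)) (bigD1 k) //=.
rewrite [X in (_ + X)%N]big1 ?addn0 => [|i ik].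
  by apply: eq_bigr => j _; rewrite eqxx mul1n.
by rewrite big1 // => j _; rewrite eq_sym (negPf ik).
Qed.

(** The multidegrees are the row sums of the positive and of the negative parts
    of s, and these differ by the row sums of s. *)
Lemma minor_multideg_parts s : balanced s ->
  minor_multideg (fun i j => pos_part (s i j)) =
  minor_multideg (fun i j => neg_part (s i j)).
Proof.
move=> [sC s0]; apply: funext => k.
do 2 (rewrite minor_multidegE => [|i j]; last by rewrite sC).
apply/eqP; rewrite -eqz_nat -subr_eq0 !(big_morph Posz PoszD (erefl _)) -sumrB.
under eq_bigr do rewrite pos_part_sub_neg_part.
exact/eqP/s0.
Qed.

Lemma minor_prod_parts s A : minor_prod s A =
  conf_eval (minor_monomial (fun i j => pos_part (s i j))) A /
  conf_eval (minor_monomial (fun i j => neg_part (s i j))) A.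
Proof.
rewrite !conf_eval_minor_monomial -prodf_div; apply: eq_bigr => i _.
by rewrite -prodf_div; apply: eq_bigr => j _; rewrite exprz_parts.
Qed.

Definition minor_fun s (x : M0n R n) : C := minor_prod s (repr x).

Lemma minor_fun_class s A :
  balanced s -> minor_fun s (M0n_class A) = minor_prod s A.
Proof.
move=> bs; apply: minor_prod_equiv => //.
by rewrite -M0n_class_eq {1}/M0n_class reprK.
Qed.

Lemma minor_fun_regular s : balanced s -> regular (minor_fun s).
Proof.
move=> bs A; exists (minor_multideg (fun i j => pos_part (s i j))),
  (minor_monomial (fun i j => pos_part (s i j))),
  (minor_monomial (fun i j => neg_part (s i j))).
split.
- exact: multihomog_minor_monomial.
- by rewrite minor_multideg_parts //; apply: multihomog_minor_monomial.
- rewrite conf_eval_minor_monomial.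
  apply/prodf_neq0 => i _; apply/prodf_neq0 => j ij.
  by rewrite expf_neq0 // conf_minor_lt.
- by move=> B _; rewrite minor_fun_class // minor_prod_parts.
Qed.

Definition aff_poly (P : {mpoly C[n * 2]}) : {mpoly C[n]} :=
  P \mPo [tuple (mxvec (\matrix_(i < n, k < 2)
                  (if k == 0 then 'X_i else 1))) 0 r | r < n * 2].

Lemma meval_aff_poly P y : (aff_poly P).@[y] = P.@[mxvec (affmx y) 0].
Proof.
rewrite /aff_poly comp_mpoly_meval; congr (_.@[_]); apply: funext => r.
rewrite tnth_mktuple; set M := \matrix_(_, _) _.
have -> : affmx y = map_mx (meval y) M.
  by apply/matrixP => i k; rewrite !mxE; case: eqP => _; rewrite ?mevalXU ?meval1.
by rewrite -map_mxvec mxE.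
Qed.

(** The value 1 where y is not injective is arbitrary: it lies off the
    complement of the arrangement. *)
Definition affine_pullback (f : M0n R n -> C) y : C :=
  if insub (affmx y) is Some A then f (M0n_class A) else 1.

Lemma affine_pullback_conf f y (y_inj : injective y) :
  affine_pullback f y = f (M0n_class (aff_conf y_inj)).
Proof.
rewrite /affine_pullback insubT ?is_conf_affmx; first exact/injectiveP.
by move=> h; congr (f (M0n_class _)); apply: val_inj.
Qed.

(** Indexed by all ordered pairs, with the constant form 1 for the pairs that
    are not increasing, so that the index type is just a product. *)
Definition diff_form (ij : 'I_n * 'I_n) : {mpoly C[n]} :=
  if (ij.1 < ij.2)%N then 'X_ij.1 - 'X_ij.2 else 1.

Lemma msize_diff_form ij : (msize (diff_form ij) <= 2)%N.
Proof.
rewrite /diff_form; case: ifP => _; last by rewrite msize1.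
apply: (leq_trans (mmeasureD_le _ _ _)).
by rewrite mmeasureN !msizeX !mdeg1.
Qed.

Lemma arr_compl_diff y : arr_compl diff_form y <-> injective y.
Proof.
split=> [h i j yij|y_inj [i j]].
  apply/val_inj/eqP/contraT; rewrite neq_ltn => /orP[] ij.
    by have := h (i, j); rewrite /diff_form ij mevalB !mevalXU yij subrr eqxx.
  by have := h (j, i); rewrite /diff_form ij mevalB !mevalXU yij subrr eqxx.
rewrite /diff_form /=; case: ltnP => ij; last by rewrite meval1 oner_neq0.
rewrite mevalB !mevalXU subr_eq0 (inj_eq y_inj).
by apply: contraTneq ij => ->; rewrite ltnn.
Qed.

Lemma affine_pullback_rational f :
  regular f -> loc_rational diff_form (affine_pullback f).
Proof.
move=> hf x /arr_compl_diff x_inj.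
have [d [P [Q [_ _ Qx E]]]] := hf (aff_conf x_inj).
exists (aff_poly P), (aff_poly Q); rewrite !meval_aff_poly; split=> //.
move=> y /arr_compl_diff y_inj; rewrite !meval_aff_poly => Qy.
by rewrite (affine_pullback_conf _ y_inj) E.
Qed.

Lemma prod_diff_form (e : 'I_n * 'I_n -> int) y :
  \prod_ij (diff_form ij).@[y] ^ e ij =
  prodlt (fun i j => y i - y j) (fun i j => e (i, j)).
Proof.
rewrite /prodlt pair_big_dep /= [RHS]big_mkcond; apply: eq_bigr => -[i j] _ /=.
by rewrite /diff_form /=; case: ifP => _; rewrite ?meval1 ?exp1rz // mevalB !mevalXU.
Qed.

End Moduli.

(** * The isomorphism from integral kinematic space to the character lattice *)

Section Kin.
Variables (R : realType) (n : nat).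
Local Notation C := R[i].
Implicit Types (s t : kinZ R n) (f g : kin_dual R n).

(** The pairing with its arguments exchanged, so that it can be declared
    additive in the functional. *)
Definition kin_eval (x : subvs_of (kin R n)) f : C := kin_pairing f x.

Lemma kin_eval_zmod x : zmod_morphism (kin_eval x).
Proof. by move=> f g; rewrite /kin_eval /kin_pairing add_lfunE opp_lfunE. Qed.

HB.instance Definition _ x :=
  GRing.isZmodMorphism.Build (kin_dual R n) C (kin_eval x) (kin_eval_zmod x).

Lemma kin_pairing_span (m : 'M[int]_n) x :
  kin_pairing (\sum_i \sum_j kin_entry R i j *~ m i j) x =
  \sum_i \sum_j vsval x i j *~ m i j.
Proof.
rewrite -/(kin_eval x _) raddf_sum; apply: eq_bigr => i _.
rewrite raddf_sum; apply: eq_bigr => j _.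
by rewrite raddfMz /= /kin_eval kin_entryE.
Qed.

Lemma kinZ_entryB s t i j :
  kinZ_entry (s - t) i j = kinZ_entry s i j - kinZ_entry t i j.
Proof.
apply: (@intr_inj C); rewrite rmorphB /= !kinZ_entryE.
have -> : kinZ_val (s - t) = kinZ_val s - kinZ_val t by [].
by rewrite linearB !mxE.
Qed.

Lemma kinZ_entry_inj s t :
  (forall i j, kinZ_entry s i j = kinZ_entry t i j) -> s = t.
Proof.
move=> st; apply/val_inj/val_inj/matrixP => i j /=.
by rewrite -!kinZ_entryE st.
Qed.

Lemma kinZ_entry_diag s i : kinZ_entry s i i = 0.
Proof.
apply: (@intr_inj C); rewrite kinZ_entryE.
by have /kinP[_ ->] := subvsP (kinZ_val s).
Qed.

Lemma kinZ_balanced s : balanced (kinZ_entry s).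
Proof.
have /kinP[sC _ s0] := subvsP (kinZ_val s).
split=> [i j|i]; apply: (@intr_inj C); first by rewrite !kinZ_entryE.
rewrite /rowsum rmorph_sum -[RHS](s0 i).
by apply: eq_bigr => j _; rewrite /= kinZ_entryE.
Qed.

Lemma kinZ_of (e : 'I_n -> 'I_n -> int) : balanced e -> (forall i, e i i = 0) ->
  exists s : kinZ R n, forall i j, kinZ_entry s i j = e i j.
Proof.
move=> [eC e0] ed; pose S : 'M[C]_n := \matrix_(i, j) (e i j)%:~R.
have kS : S \in kin R n.
  apply/kinP; split=> [i j|i|i].
  - by rewrite !mxE eC.
  - by rewrite mxE ed.
  - transitivity ((rowsum e i)%:~R : C); last by rewrite e0.
    by rewrite /rowsum rmorph_sum; apply: eq_bigr => j _; rewrite mxE.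
have SE : vsval (Subvs kS) = S by [].
have ZS : Subvs kS \in @kinZ_pred R n.
  apply/asboolP => -[f /= /asboolP[m ->]]; rewrite kin_pairing_span SE.
  exists (\sum_i \sum_j e i j * m i j); rewrite rmorph_sum; apply: eq_bigr => i _.
  rewrite rmorph_sum; apply: eq_bigr => j _.
  by rewrite mxE -mulrzl mulrC -rmorphM.
exists (KinZ ZS) => i j; apply: (@intr_inj C); rewrite kinZ_entryE.
by rewrite [vsval _]SE mxE.
Qed.

Definition kin_coord s : coord_ring R n :=
  CoordRing (asboolT (minor_fun_regular (kinZ_balanced s))).

Lemma kin_coord_class s (A : conf R n) :
  coord_fun (kin_coord s) (M0n_class A) = minor_prod (kinZ_entry s) A.
Proof. by rewrite /= minor_fun_class //; apply: kinZ_balanced. Qed.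

Lemma coord_ring_ext (a b : coord_ring R n) :
  (forall A, coord_fun a (M0n_class A) = coord_fun b (M0n_class A)) -> a = b.
Proof.
move=> ab; apply/val_inj/funext => x; have [A ->] := M0n_classP x; exact: ab.
Qed.

Lemma coord_funM (a b : coord_ring R n) x :
  coord_fun (a * b) x = coord_fun a x * coord_fun b x.
Proof. by []. Qed.

Lemma kin_coordD s t : kin_coord (s + t) = kin_coord s * kin_coord t.
Proof.
apply: coord_ring_ext => A; rewrite coord_funM !kin_coord_class -prodltD.
  2: exact: conf_minor_lt.
apply: eq_prodlt => // i j _; have := kinZ_entryB (s + t) t i j.
by rewrite addrK => ->; rewrite subrK.
Qed.

Lemma kin_coord0 : kin_coord 0 = 1.
Proof.
apply: coord_ring_ext => A; rewrite kin_coord_class.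
rewrite /minor_prod /prodlt big1 // => i _; rewrite big1 // => j _.
by have := kinZ_entryB 0 0 i j; rewrite !subrr => ->; rewrite expr0z.
Qed.

Lemma kin_coord_unit s : `[< exists b, kin_coord s * b = 1 >].
Proof.
by apply/asboolP; exists (kin_coord (- s)); rewrite -kin_coordD subrr kin_coord0.
Qed.

Definition kin_unit s : units (coord_ring R n) := Units (kin_coord_unit s).

Lemma kin_unitD s t : kin_unit (s + t) = kin_unit s + kin_unit t.
Proof. by apply: val_inj; rewrite /= kin_coordD. Qed.

Lemma unit_class_zmod : zmod_morphism (@unit_class R n).
Proof. exact: (raddfB (\pi_(Quotient.quot (@scalar_units R n)))). Qed.

Lemma unit_class_eq (u v : units (coord_ring R n)) :
  unit_class u = unit_class v <-> u - v \in @scalar_units R n.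
Proof. by rewrite /unit_class Quotient.idealrBE; split=> /eqP. Qed.

Definition kin_char s : char_lattice R n := unit_class (kin_unit s).

Lemma kin_char_zmod : zmod_morphism kin_char.
Proof.
move=> s t; rewrite /kin_char -unit_class_zmod; congr unit_class.
by apply: (addIr (kin_unit t)); rewrite subrK -kin_unitD subrK.
Qed.

HB.instance Definition _ :=
  GRing.isZmodMorphism.Build (kinZ R n) (char_lattice R n) kin_char kin_char_zmod.

Lemma unit_neq0 (u : units (coord_ring R n)) x : coord_fun (units_val u) x != 0.
Proof.
apply/eqP => u0; have /(congr1 (fun a => coord_fun a x)) := units_valN u.
by rewrite coord_funM [coord_fun _ x]u0 mul0r => /esym/eqP; apply/negP/oner_neq0.
Qed.

Lemma unit_class_scalar (u v : units (coord_ring R n)) (c : C) : c != 0 ->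
  (forall x, coord_fun (units_val u) x = c * coord_fun (units_val v) x) ->
  unit_class u = unit_class v.
Proof.
move=> c0 uv; apply/unit_class_eq/asboolP; exists c => // x.
have vN : coord_fun (units_val v) x * coord_fun (units_val (- v)) x = 1.
  by have /(congr1 (fun a => coord_fun a x)) := units_valN v.
by rewrite [LHS](coord_funM _ (units_val (- v))) uv -mulrA vN mulr1.
Qed.

(** Up to a sign, the product over all ordered pairs is the square of the
    product over i < j.  It is used to isolate the factors that involve one
    given point without distinguishing its position among the others. *)
Lemma prodlt_sq (F : fieldType) (u : 'I_n -> 'I_n -> F) (e : 'I_n -> 'I_n -> int) :
    (forall i j, e i j = e j i) -> (forall i j, u j i = - u i j) ->
  \prod_(i < n) \prod_(j < n | j != i) u i j ^ e i j =
  prodlt (fun _ _ => -1) e * prodlt u e ^+ 2.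
Proof.
move=> eC uN; rewrite -big_ltn_pair expr2 /prodlt -!big_split.
apply: eq_bigr => i _ /=; rewrite -!big_split; apply: eq_bigr => j _ /=.
by rewrite [e j i]eC [u j i]uN -[- u i j]mulN1r [(-1 * _) ^ _]expfzMl mulrCA.
Qed.

(** Let the k-th point z vary and fix the others: by [prodlt_sq], the product
    of the (z - a_j)^(2 s_kj) is constant, and [prod_linear_const] applies. *)
Lemma minor_prod_const s (c : C) :
  (forall A : conf R n, minor_prod (kinZ_entry s) A = c) -> s = 0.
Proof.
move=> Fc; apply: kinZ_entry_inj => k l.
have -> : kinZ_entry (0 : kinZ R n) k l = 0.
  by have := kinZ_entryB 0 0 k l; rewrite !subrr.
have [sC _] := kinZ_balanced s.
pose a (i : 'I_n) : C := i%:R.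
have a_inj : injective a by move=> i j /eqP; rewrite eqr_nat => /eqP/val_inj.
suff /(_ l) /eqP : forall j, kinZ_entry s k j *+ 2 = 0.
  by rewrite mulrn_eq0 => /eqP.
pose e := kinZ_entry s; have eC : forall i j, e i j = e j i := sC.
(* The product over all ordered pairs is S * T times the factors involving z:
   T collects the pairs avoiding k, S the signs of z - a_i against a_i - z. *)
pose T := \prod_(i | i != k) \prod_(j | (j != i) && (j != k)) (a i - a j) ^ e i j.
have T0 : T != 0.
  apply/prodf_neq0 => i _; apply/prodf_neq0 => j /andP[ji _].
  by rewrite expfz_neq0 // subr_eq0 (inj_eq a_inj) eq_sym.
pose S := \prod_(i | i != k) (-1 : C) ^ e i k.
have S0 : S != 0.
  by apply/prodf_neq0 => i _; rewrite expfz_neq0 // oppr_eq0 oner_neq0.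
apply: (prod_linear_const a_inj
  (c := prodlt (fun _ _ => -1) e * c ^+ 2 / (S * T))) => z za.
pose y i := if i == k then z else a i.
have y_inj : injective y.
  move=> i j; rewrite /y; case: eqP => [->|_]; case: eqP => [->|_] //.
  - by move/eqP; rewrite (negPf (za j)).
  - by move/esym/eqP; rewrite (negPf (za i)).
  - exact: a_inj.
have sq := @prodlt_sq _ (fun i j => y i - y j) e sC (fun i j => esym (opprB _ _)).
have FE := Fc (aff_conf y_inj).
rewrite (_ : prodlt (fun i j => y i - y j) e = c) in sq; last first.
  by rewrite -FE; apply: eq_prodlt => // i j _; rewrite minor_affmx.
rewrite -sq [in RHS](bigD1 k) //=.
have -> : \prod_(i < n | i != k) \prod_(j < n | j != i) (y i - y j) ^ e i j =
    S * T * \prod_(j < n | j != k) (z - a j) ^ e k j.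
  rewrite /S /T -!big_split; apply: eq_bigr => i ik /=.
  rewrite (bigD1 k) 1?eq_sym //= {1 2}/y eqxx (negPf ik) -opprB.
  rewrite -[- (z - a i)]mulN1r [(-1 * _) ^ _]expfzMl.
  rewrite (eC k i) [RHS]mulrAC; congr (_ * _ * _).
  apply: eq_bigr => j /andP[_ jk]; by rewrite /y (negPf ik) (negPf jk).
rewrite [RHS]mulrC [in RHS]mulrCA mulKf ?mulf_neq0 //.
rewrite (bigD1 k) //= kinZ_entry_diag mul0rn expr0z mul1r -big_split /=.
by apply: eq_bigr => j jk; rewrite /y eqxx (negPf jk) mulr2n expfzDr // subr_eq0.
Qed.

Lemma kin_char_inj : injective kin_char.
Proof.
apply: (raddf_inj (f := kin_char)) => s s0.
have /unit_class_eq : unit_class (kin_unit s) = unit_class 0.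
  by rewrite -(subrr 0) unit_class_zmod subrr.
rewrite subr0 => /asboolP[c c0 E]; apply: (@minor_prod_const s c) => A.
by rewrite -kin_coord_class; apply: E.
Qed.

(** The class is unchanged under the exchange of the two homogeneous
    coordinates. *)
Lemma swap_affine (y : 'I_n -> C) (y_inj : injective y) (y0 : forall i, y i != 0)
    (z_inj : injective (fun i => (y i)^-1)) :
  M0n_class (aff_conf y_inj) = M0n_class (aff_conf z_inj).
Proof.
apply/eqP; rewrite M0n_class_eq; apply/asboolP.
exists (\row_i (y i)^-1), (\matrix_(i, j) (i != j)%:R); split=> [i||].
- by rewrite mxE invr_eq0.
- rewrite unitmxE unitfE (expand_det_col _ 0) !big_ord_recl big_ord0.
  rewrite /cofactor !det_mx11 !mxE /=.
  by rewrite expr1 mul0r add0r addr0 mul1r mulr1 oppr_eq0 oner_neq0.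
apply/matrixP => i k; rewrite -mulmxA mul_diag_mx !mxE.
rewrite !big_ord_recl big_ord0 addr0 !mxE.
have -> : lift ord0 ord0 = 1 :> 'I_2 by apply: val_inj.
have -> : ord0 = 0 :> 'I_2 by apply: val_inj.
case: (ord2_01 k) => -> /=; first by rewrite mulr0 add0r !mulr1.
by rewrite mulr0 addr0 mulr1 mulVf.
Qed.

Lemma unit_affine (u : units (coord_ring R n)) :
  exists (c : C) (e : 'I_n -> 'I_n -> int),
    [/\ c != 0, forall i j, e i j = e j i, forall i, e i i = 0
      & forall y (y_inj : injective y),
          coord_fun (units_val u) (M0n_class (aff_conf y_inj)) =
          c * prodlt (fun i j => y i - y j) e].
Proof.
have ur : regular (coord_fun (units_val u)) by case: (units_val u) => f /= /asboolP.
have [|||c [e [c0 uE]]] := @arrangement_unit _ _ _ _ (@msize_diff_form R n)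
  (affine_pullback (coord_fun (units_val u))) _ _ (fun i => i%:R).
- exact: affine_pullback_rational.
- move=> y /arr_compl_diff y_inj.
  by rewrite (affine_pullback_conf _ y_inj) unit_neq0.
- by apply/arr_compl_diff => i j /eqP; rewrite eqr_nat => /eqP/val_inj.
exists c, (fun i j : 'I_n =>
  if (i < j)%N then e (i, j) else if (j < i)%N then e (j, i) else 0).
split=> // [i j|i|y y_inj]; first by case: ltngtP.
  by rewrite ltnn.
rewrite -affine_pullback_conf uE; last exact/arr_compl_diff.
by rewrite prod_diff_form; congr (_ * _); apply: eq_prodlt => // i j ->.
Qed.

(** By [swap_affine] the product of the y_i^(- row sum i) is a sign independent
    of y.  Multiplying the single coordinate y_k by n + 2 changes it by
    (n + 2)^(- row sum k), which is therefore 1. *)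
Lemma affine_balanced (u : units (coord_ring R n)) c e :
    c != 0 -> (forall i j, e i j = e j i) ->
    (forall y (y_inj : injective y),
       coord_fun (units_val u) (M0n_class (aff_conf y_inj)) =
       c * prodlt (fun i j => y i - y j) e) ->
  balanced e.
Proof.
move=> c0 eC uE; split=> // k.
pose T := \sum_(i < n) \sum_(j < n | (i < j)%N) e i j.
have key (y : 'I_n -> C) : injective y -> (forall i, y i != 0) ->
    \prod_i (y i)^-1 ^ rowsum e i * (-1) ^ T = 1.
  move=> y_inj y0; have z_inj : injective (fun i => (y i)^-1).
    by move=> i j /invr_inj/y_inj.
  have := uE _ z_inj; rewrite -(swap_affine y_inj y0) uE => /(mulfI c0).
  rewrite [RHS](@prodlt_scale _ _ _ (fun i j => y i - y j) e
    (fun i => (y i)^-1) (-1)) //.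
  - move=> /esym/eqP; rewrite -[X in _ == X]mul1r => /eqP; apply: mulIf.
    by apply: prodlt_neq0 => i j ij; rewrite subr_eq0 (inj_eq y_inj) neq_ltn ij.
  - by rewrite oppr_eq0 oner_neq0.
  - by move=> i; rewrite invr_eq0.
  - by move=> i j _; field; rewrite !y0.
(* (n + 2)(k + 1) exceeds every j + 1, so z is injective as well. *)
pose y (i : 'I_n) : C := i.+1%:R.
pose z (i : 'I_n) : C := if i == k then (n.+2 * k.+1)%N%:R else i.+1%:R.
have y0 i : y i != 0 by rewrite /y pnatr_eq0.
have z0 i : z i != 0 by rewrite /z; case: (i == k); rewrite pnatr_eq0.
have y_inj : injective y by move=> i j /eqP; rewrite eqr_nat eqSS => /eqP/val_inj.
have big_k (j : 'I_n) : (n.+2 * k.+1 == j.+1)%N = false.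
  apply: gtn_eqF; rewrite (leq_ltn_trans (ltn_ord j)) //.
  by rewrite (leq_trans (ltnW (ltnSn _))) // leq_pmulr.
have z_inj : injective z.
  move=> i j; rewrite /z; case: eqP => [->|_]; case: eqP => [->|_] // /eqP;
    rewrite eqr_nat.
  - by rewrite big_k.
  - by rewrite eq_sym big_k.
  - by rewrite eqSS => /eqP/val_inj.
have := etrans (key _ y_inj y0) (esym (key _ z_inj z0)).
have N1 : (-1 : C) ^ T != 0 by rewrite expfz_neq0 // oppr_eq0 oner_neq0.
move=> /(mulIf N1); rewrite (bigD1 k) //= [RHS](bigD1 k) //=.
rewrite [X in _ = _ * X](eq_bigr (fun i => (y i)^-1 ^ rowsum e i)); last first.
  by move=> i ik; rewrite /z (negPf ik).
set W := (X in _ * X = _); have W0 : W != 0.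
  by apply/prodf_neq0 => i _; rewrite expfz_neq0 // invr_eq0.
move=> /(mulIf W0) E.
have : (n.+2%:R : C)^-1 ^ rowsum e k = 1.
  apply: (mulIf (_ : (y k)^-1 ^ rowsum e k != 0)).
    by rewrite expfz_neq0 // invr_eq0.
  by rewrite mul1r [RHS]E -expfzMl -invfM /z /y eqxx natrM.
move/eqP; rewrite pexprz_eq1 ?invr_ge0 ?ler0n // => /orP[/eqP //|].
by rewrite invr_eq1 (eqr_nat _ _ 1).
Qed.

Lemma kin_char_surj (a : char_lattice R n) : exists s, kin_char s = a.
Proof.
pose u : units (coord_ring R n) := repr a.
have ua : unit_class u = a by rewrite /unit_class reprK.
have [c [e [c0 eC e0 uE]]] := unit_affine u.
have be := affine_balanced c0 eC uE.
have [s sE] := kinZ_of be e0; exists s; rewrite -ua.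
apply/esym/(unit_class_scalar c0) => x; have [A ->] := M0n_classP x.
have [y [y_inj ->]] := exists_affine A.
rewrite uE [in RHS]kin_coord_class; congr (_ * _).
by apply: eq_prodlt => i j _; rewrite ?minor_affmx ?sE.
Qed.

End Kin.

(** * The dual isomorphism *)

Section Quad.
Variables (n : nat).

(** The symmetric adjacency matrix of the edge {i, j}. *)
Definition edge (i j k l : 'I_n) : int :=
  ((k == i) && (l == j))%:R + ((k == j) && (l == i))%:R.

Lemma edgeC i j k l : edge i j k l = edge i j l k.
Proof. by rewrite /edge addrC ![(l == _) && _]andbC. Qed.

Lemma rowsum_edge i j k : i != j -> rowsum (edge i j) k = (k == i)%:R + (k == j)%:R.
Proof.
move=> ij.
have E (u v : 'I_n) : u != v ->
    \sum_(l | l != k) ((k == u) && (l == v))%:R = (k == u)%:R :> int.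
  move=> uv; have [->|ku] := eqVneq k u; last by rewrite big1.
  rewrite (bigD1 v) 1?eq_sym //= eqxx big1 ?addr0 // => l /andP[_ /negPf->] //.
by rewrite /rowsum big_split /= !E // eq_sym.
Qed.

Variables a b c : 'I_n.

(** The edge {i, j} corrected by edges at c and by the triangle a b c, so that
    all row sums vanish.  Away from the row and column of c, it differs from
    the edge {i, j} only at the entries (a, b) and (b, a). *)
Definition quad (i j k l : 'I_n) : int :=
  edge i j k l - edge i c k l - edge j c k l - edge a b k l
  + edge a c k l + edge b c k l.

Hypotheses (ab : a != b) (ac : a != c) (bc : b != c).

Lemma quad_balanced i j : i != j -> i != c -> j != c -> balanced (quad i j).
Proof.
move=> ij ic jc; split=> [k l|k].
  by rewrite /quad !(edgeC _ _ k l).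
transitivity (rowsum (edge i j) k - rowsum (edge i c) k - rowsum (edge j c) k
    - rowsum (edge a b) k + rowsum (edge a c) k + rowsum (edge b c) k).
  by rewrite /rowsum -!sumrB -!big_split.
by rewrite !rowsum_edge //; ring.
Qed.

Lemma quad_diag i j k : i != j -> i != c -> j != c -> quad i j k k = 0.
Proof.
have E (u v : 'I_n) : u != v -> edge u v k k = 0.
  move=> uv; rewrite /edge; case: eqVneq => [->|_];
    by rewrite ?(negPf uv) ?andbF //= eq_sym.
by move=> ij ic jc; rewrite /quad !E // !(subr0, addr0).
Qed.

Lemma quad_main (i j k l : 'I_n) : (i < j)%N -> (k < l)%N -> k != c -> l != c ->
  quad i j k l = ((k == i) && (l == j))%:R - edge a b k l.
Proof.
move=> ij kl kc lc; have E (u : 'I_n) : edge u c k l = 0.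
  by rewrite /edge (negPf kc) (negPf lc) andbF.
have kj : (k == j) && (l == i) = false.
  by apply/andP => -[/eqP kj /eqP li]; move: kl; rewrite kj li ltnNge (ltnW ij).
by rewrite /quad !E !(subr0, addr0) {1}/edge kj addr0.
Qed.
End Quad.

Section Kin.
Variables (R : realType) (n : nat).
Local Notation C := R[i].
Implicit Types (s t : kinZ R n) (f g : kin_dualZ R n).

(** The entries in the row and column of c are recovered from the row sums. *)
Lemma kin_off_det (c : 'I_n) (x : subvs_of (kin R n)) :
  (forall k l : 'I_n, (k < l)%N -> k != c -> l != c -> vsval x k l = 0) ->
  x = 0.
Proof.
have /kinP[xC xd x0] := subvsP x => h.
have off k l : k != c -> l != c -> vsval x k l = 0.
  move=> kc lc; have [kl|lk|/val_inj->] := ltngtP k l; first exact: h.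
    by rewrite xC h.
  exact: xd.
have offc k : vsval x k c = 0.
  have [->|kc] := eqVneq k c; first exact: xd.
  rewrite -(x0 k) (bigD1 c) 1?eq_sym //= big1 ?addr0 // => l /andP[_ lc].
  exact: off.
apply/val_inj/matrixP => k l; rewrite mxE.
have [->|lc] := eqVneq l c; first exact: offc.
have [->|kc] := eqVneq k c; first by rewrite /= xC offc.
exact: off.
Qed.

(** Twice this sum is the sum of the row sums other than that of c, minus the
    sum of the entries s_ic, which is the row sum of c. *)
Lemma kin_off_sum (c : 'I_n) (x : subvs_of (kin R n)) :
  \sum_(i < n) \sum_(j < n | (i < j)%N && ((i != c) && (j != c))) vsval x i j = 0.
Proof.
have /kinP[xC xd x0] := subvsP x.
pose G i j := if (i != c) && (j != c) then vsval x i j else 0.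
have GC i j : G i j = G j i by rewrite /G andbC xC.
set S := (X in X = 0).
suff /eqP : S *+ 2 = 0 by rewrite mulrn_eq0 => /eqP.
have -> : S = \sum_(i < n) \sum_(j < n | (i < j)%N) G i j.
  by apply: eq_bigr => i _; rewrite big_mkcondr.
rewrite mulr2n -big_split /=.
under eq_bigr => i _ do rewrite -big_split /=.
under eq_bigr => i _ do under eq_bigr => j _ do rewrite {2}GC.
rewrite (big_ltn_pair _ G) (bigD1 c) //= big1 ?add0r.
  2: by move=> j _; rewrite /G eqxx.
have E i : i != c -> \sum_(j < n | j != i) G i j = - vsval x c i.
  move=> ic; have := x0 i; rewrite (bigD1 c) 1?eq_sym //= => /eqP.
  rewrite addrC addr_eq0 xC => /eqP <-.
  rewrite (bigD1 c) 1?eq_sym //= {1}/G eqxx andbF add0r.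
  by apply: eq_bigr => j /andP[_ jc]; rewrite /G ic jc.
by rewrite (eq_bigr _ E) sumrN x0 oppr0.
Qed.

(** The points q i j are the [quad] matrices, for i < j different from the last
    index c.  Away from c, the sum has the entries of x, except at (a, b) where
    the correction is the sum that vanishes by [kin_off_sum]; and these entries
    determine x by [kin_off_det]. *)
Lemma kin_integral_basis : (2 < n)%N ->
  exists (P : rel 'I_n) (q : 'I_n -> 'I_n -> kinZ R n),
    forall x : subvs_of (kin R n),
      x = \sum_i \sum_(j | P i j) vsval x i j *: kinZ_val (q i j).
Proof.
move=> n2; pose a := Ordinal (ltnW (ltnW n2)); pose b := Ordinal (ltnW n2).
pose c := Ordinal n2.
pose P (i j : 'I_n) := (i < j)%N && ((i != c) && (j != c)).
have /choice[q qE] : forall ij : 'I_n * 'I_n, exists s : kinZ R n,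
    P ij.1 ij.2 -> forall k l, kinZ_entry s k l = quad a b c ij.1 ij.2 k l.
  move=> [i j] /=; case Pij : (P i j); last by exists 0.
  have /and3P[ij ic jc] := Pij; have {}ij : i != j by rewrite neq_ltn ij.
  have [||s sE] := @kinZ_of R n (quad a b c i j).
  - exact: quad_balanced.
  - by move=> k; apply: quad_diag.
  by exists s.
exists P, (fun i j => q (i, j)) => x.
apply/eqP; rewrite -subr_eq0; apply/eqP/(@kin_off_det c) => k l kl kc lc.
rewrite linearB linear_sum !mxE summxE; apply/eqP; rewrite subr_eq0; apply/eqP.
transitivity (\sum_i \sum_(j | P i j)
    vsval x i j * (((k == i) && (l == j))%:R - (edge a b k l)%:~R)); last first.
  apply: eq_bigr => i _; rewrite linear_sum summxE; apply: eq_bigr => j Pij.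
  rewrite linearZ mxE -kinZ_entryE (qE (i, j)) //= quad_main //; last by case/andP: Pij.
  by rewrite rmorphB rmorph_nat.
under eq_bigr do (under eq_bigr do rewrite mulrBr; rewrite sumrB -mulr_suml).
rewrite sumrB -mulr_suml kin_off_sum mul0r subr0.
rewrite (bigD1 k) //= (bigD1 l) /=; last by rewrite /P kl kc lc.
rewrite !eqxx mulr1 big1 => [|j /andP[_ /negPf jl]]; last by rewrite eq_sym jl mulr0.
rewrite addr0 big1 ?addr0 // => i ik; rewrite big1 // => j _.
by rewrite eq_sym (negPf ik) mulr0.
Qed.

Lemma pairing_integral f s :
  exists m : int, kin_pairing (kin_dualZ_val f) (kinZ_val s) = m%:~R.
Proof. by have /asboolP := valP s; apply. Qed.

Definition pairingZ f s : int := sval (cid (pairing_integral f s)).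

Lemma pairingZE f s :
  (pairingZ f s)%:~R = kin_pairing (kin_dualZ_val f) (kinZ_val s).
Proof. by rewrite /pairingZ; case: cid. Qed.

Definition char_pt (a : char_lattice R n) : kinZ R n :=
  sval (cid (kin_char_surj a)).

Lemma char_ptK : cancel char_pt (@kin_char R n).
Proof. by move=> a; rewrite /char_pt; case: cid. Qed.

Lemma kin_charK : cancel (@kin_char R n) char_pt.
Proof. by move=> s; apply: kin_char_inj; rewrite char_ptK. Qed.

Lemma pairing_int_dual f :
  (fun a => pairingZ f (char_pt a)) \in @int_dual_pred (char_lattice R n).
Proof.
apply/asboolP => a b.
have -> : char_pt (a - b) = char_pt a - char_pt b.
  by apply: kin_char_inj; rewrite raddfB /= !char_ptK.
by apply: (@intr_inj C); rewrite rmorphB /= !pairingZE -kin_pairingB.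
Qed.

Definition kin_cochar f : cochar_lattice R n := IntDual (pairing_int_dual f).

Lemma kin_cocharE f s :
  (int_dual_fun (kin_cochar f) (kin_char s))%:~R =
  kin_pairing (kin_dualZ_val f) (kinZ_val s).
Proof. by rewrite /= kin_charK pairingZE. Qed.

Lemma cochar_ext (h k : cochar_lattice R n) :
  (forall s, (int_dual_fun h (kin_char s))%:~R =
             (int_dual_fun k (kin_char s))%:~R :> C) ->
  h = k.
Proof.
move=> hk; apply/val_inj/funext => a; apply: (@intr_inj C).
by rewrite -(char_ptK a); apply: hk.
Qed.

Lemma kin_cochar_zmod : zmod_morphism kin_cochar.
Proof.
move=> f g; apply: cochar_ext => s; rewrite kin_cocharE.
have -> : int_dual_fun (kin_cochar f - kin_cochar g) (kin_char s) =
  int_dual_fun (kin_cochar f) (kin_char s) - int_dual_fun (kin_cochar g) (kin_char s) by [].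
by rewrite rmorphB /= !kin_cocharE -!/(kin_eval _ _) -raddfB.
Qed.

HB.instance Definition _ :=
  GRing.isZmodMorphism.Build (kin_dualZ R n) (cochar_lattice R n) kin_cochar kin_cochar_zmod.

Lemma kin_cochar_inj : (2 < n)%N -> injective kin_cochar.
Proof.
move=> n2; apply: (raddf_inj (f := kin_cochar)) => f f0.
have [P [q qE]] := kin_integral_basis n2.
apply/val_inj/lfunP => x; rewrite [RHS]lfunE /= {1}(qE x) linear_sum big1 //= => i _.
rewrite linear_sum big1 // => j _; rewrite linearZ /=.
have := kin_cocharE f (q i j); rewrite f0 /kin_pairing => <-.
by rewrite scaler0.
Qed.

(** A homomorphism h is determined by its values on the points q i j, so it is
    the pairing with the sum of the h(q i j) s_ij. *)
Lemma kin_cochar_surj (h : cochar_lattice R n) : (2 < n)%N -> exists f, kin_cochar f = h.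
Proof.
move=> n2; have [P [q qE]] := kin_integral_basis n2.
have Hz : zmod_morphism (fun s => int_dual_fun h (kin_char s)).
  by move=> s t; rewrite raddfB; have /asboolP := valP h; apply.
pose H : {additive kinZ R n -> int} :=
  HB.pack (fun s => int_dual_fun h (kin_char s)) (GRing.isZmodMorphism.Build _ _ _ Hz).
pose m : 'M[int]_n := \matrix_(i, j) if P i j then H (q i j) else 0.
have fZ : \sum_i \sum_j kin_entry R i j *~ m i j \in @kin_dualZ_pred R n.
  by apply/asboolP; exists m.
exists (KinDualZ fZ); apply: cochar_ext => s; rewrite kin_cocharE /= kin_pairing_span.
have sE : s = \sum_i \sum_(j | P i j) q i j *~ kinZ_entry s i j.
  apply: val_inj; rewrite [LHS](qE (kinZ_val s)) raddf_sum; apply: eq_bigr => i _.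
  rewrite raddf_sum; apply: eq_bigr => j _.
  by rewrite raddfMz /= -kinZ_entryE scaler_int.
rewrite -[int_dual_fun h _]/(H s) {2}sE (raddf_sum H) rmorph_sum; apply: eq_bigr => i _.
rewrite (raddf_sum H) rmorph_sum [RHS]big_mkcond; apply: eq_bigr => j _.
rewrite mxE; case: (P i j) => //.
by rewrite raddfMz -kinZ_entryE -mulrzl -rmorphM /= mulrzz mulrC.
Qed.

End Kin.

Theorem proposition3p3 (R : realType) (n : nat) (hn : (4 <= n)%N) :
  exists (phi : {additive kinZ R n -> char_lattice R n})
         (psi : {additive kin_dualZ R n -> cochar_lattice R n}),
    [/\ bijective phi,
        forall s : kinZ R n, exists u : units (coord_ring R n),
          phi s = unit_class u /\
          forall A : conf R n, (forall i, A i 1 != 0) ->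
            coord_fun (units_val u) (M0n_class A) =
              \prod_(i < n) \prod_(j < n | (i < j)%N)
                (sigma A i - sigma A j) ^ kinZ_entry s i j,
        bijective psi
      & forall (f : kin_dualZ R n) (s : kinZ R n),
          (int_dual_fun (psi f) (phi s))%:~R =
            kin_pairing (kin_dualZ_val f) (kinZ_val s)].
Proof.
have n2 : (2 < n)%N := ltnW hn.
exists (@kin_char R n), (@kin_cochar R n); split.
- exact: Bijective (@kin_charK R n) (@char_ptK R n).
- move=> s; exists (kin_unit s); split=> // A A1.
  by rewrite [LHS]kin_coord_class minor_prod_sigma //; apply: kinZ_balanced.
- have /choice[g gK] := fun h : cochar_lattice R n => kin_cochar_surj h n2.
  by exists g => // f; apply: (kin_cochar_inj n2); rewrite gK.
- exact: kin_cocharE.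
Qed.
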